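(* Let $f_{\mathrm{sw}}^s$ be the solution of the semi-discrete Vlasov-Poisson equations in the symmetrically weighted (SW) formulation, as given in the context. Consider the total energy $\mathcal{E}(t)=\mathcal{E}_{\mathrm{kin}}(t)+\mathcal{E}_{\mathrm{pot}}(t)$, where $$\mathcal{E}_{\mathrm{kin}}(t)=\frac12\sum_sm^s\int_0^\ell\int_{\mathbb{R}}v^2f_{\mathrm{sw}}^s(x,v,t)\,\mathrm{d}v\,\mathrm{d}x,\qquad \mathcal{E}_{\mathrm{pot}}(t)=\frac12\int_0^\ell E(x,t)^2\,\mathrm{d}x.$$ Then $\mathcal{E}$ is conserved in time if $N_v$ is odd and $u^s=0$ for all $s$, and its drift rate is, if $N_v$ is odd, $$\frac{\mathrm{d}\mathcal{E}}{\mathrm{d}t}=-\Delta x\,N_v\,\mathcal{I}_{N_v-1}\,\mathbf{E}(t)^\top\sum_su^s\alpha^sq^s\,\mathbf{C}_{N_v-1}^s(t),$$ and, if $N_v$ is even, $$\frac{\mathrm{d}\mathcal{E}}{\mathrm{d}t}=-\Delta x\sqrt{\frac{N_v-1}{2}}\;\mathcal{I}_{N_v-2}\,\mathbf{E}(t)^\top\sum_sq^s\left(\frac{(2N_v-1)(\alpha^s)^2+(u^s)^2}{2}\,\mathbf{C}_{N_v-1}^s(t)+\frac{q^s}{m^s}(\mathbf{D}^p)^\dagger\big(\mathbf{E}(t)\odot\mathbf{C}_{N_v-1}^s(t)\big)\right),$$ where $(\mathbf{D}^p)^\dagger\in\mathbb{R}^{N_x\times N_x}$ is the pseudoinverse of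 the finite difference operator $\mathbf{D}^p$.
   Context: Finitely many species $s$ have constants $q^s,u^s\in\mathbb{R}$ and $m^s,\alpha^s>0$; $N_v\ge1$ is the number of velocity modes. The spatial domain $[0,\ell]$ is periodic, with a uniform grid $x^{(1)},\dots,x^{(N_x)}$, spacing $\Delta x=\ell/N_x$. Basis: $\psi_n(\xi)=(\sqrt\pi2^nn!)^{-1/2}\mathcal H_n(\xi)e^{-\xi^2/2}$ with physicists' Hermite polynomials $\mathcal H_n$, $\xi^s=(v-u^s)/\alpha^s$; $\mathcal{I}_n=\int_{\mathbb R}\psi_n(\xi)\,\mathrm d\xi$. $\mathbf{D}^p\in\mathbb{R}^{N_x\times N_x}$ is the periodic centered finite difference matrix of even order $p$ ($N_x>p$): the circulant matrix $\mathbf{D}^p_{jk}=d^p_{(k-j)\bmod N_x}$ with $d_0^p=0$; for $1\le k\le p/2=:r$, $d_k^p=\frac{1}{\Delta x}\frac{(-1)^{k+1}(r!)^2}{k(r-k)!(r+k)!}$ and $d_{N_x-k}^p=-d_k^p$; all other $d_k^p=0$. Semi-discrete SW system: functions $\mathbf{C}_n^s(t)\in\mathbb{R}^{N_x}$ ($0\le n\le N_v-1$; convention $\mathbf C_{-1}^s=\mathbf C_{N_v}^s=0$) and $\mathbf E(t)=[E(x^{(1)},t),\dots,E(x^{(N_x)},t)]^\top\in\mathbb{R}^{N_x}$ with $$\frac{\mathrm d\mathbf C_n^s}{\mathrm dt}=-\mathbf D^p\Big(\alpha^s\sqrt{\tfrac n2}\,\mathbf C_{n-1}^s+\alpha^s\sqrt{\tfrac{n+1}2}\,\mathbf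 C_{n+1}^s+u^s\mathbf C_n^s\Big)+\frac{q^s}{m^s\alpha^s}\mathbf E\odot\Big(\sqrt{\tfrac n2}\,\mathbf C_{n-1}^s-\sqrt{\tfrac{n+1}2}\,\mathbf C_{n+1}^s\Big),$$ $$\mathbf D^p\mathbf E(t)=\sum_sq^s\alpha^s\sum_{n=0}^{N_v-1}\mathcal I_n\mathbf C_n^s(t),$$ where $\odot$ is the entrywise product, and the condition $\int_0^\ell E(x,t)\,\mathrm dx=0$ is imposed for all $t$ (with the trapezoidal rule below: $\mathbf 1^\top\mathbf E(t)=0$, where $\mathbf 1$ is the all-ones vector). The solution is $f^s_{\mathrm{sw}}(x^{(j)},v,t)=\sum_{n=0}^{N_v-1}(\mathbf C_n^s(t))_j\,\psi_n(\xi^s)$. All integrals over $x$ are evaluated by the periodic trapezoidal rule $\int_0^\ell g\,\mathrm dx:=\Delta x\sum_jg(x^{(j)})$, so $\mathcal E_{\mathrm{kin}}=\frac{\Delta x}{2}\sum_s\alpha^sm^s\sum_{n=0}^{N_v-1}\mathcal I_n^{2,s}\,\mathbf 1^\top\mathbf C_n^s$ with $\mathcal I_n^{2,s}=\int_{\mathbb R}(\alpha^s\xi+u^s)^2\psi_n(\xi)\,\mathrm d\xi$, and $\mathcal E_{\mathrm{pot}}=\frac{\Delta x}{2}\mathbf E^\top\mathbf E$.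
   Formalization: For N_x even, the field E is additionally required to have no sawtooth component, sum_j (-1)^j E(x^(j),t) = 0; without it D^p E = rho and 1^T E = 0 leave c(t)(-1)^j free in E and the claim fails (take all C = 0). *)

(* Defs.v *)
(* MathComp / MathComp-Analysis development. *)
From HB Require Import structures.
From mathcomp Require Import all_boot all_order all_algebra.
From mathcomp Require Import all_classical all_reals all_analysis.

Set Implicit Arguments.
Unset Strict Implicit.
Unset Printing Implicit Defensive.

Import Order.TTheory GRing.Theory Num.Theory.
Import numFieldNormedType.Exports.

Local Open Scope classical_set_scope.
Local Open Scope ring_scope.

(* Physicists' Hermite polynomials H_n(x) = (-1)^n e^{x^2} (e^{-x^2})^{(n)};
   differentiating this formula gives H_{n+1} = 2 x H_n - H_n'. *)
Fixpoint hermite (R : realType) (n : nat) : {poly R} :=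
  if n is k.+1 then 2%:R *: ('X * hermite R k) - (hermite R k)^`() else 1.

Definition psi (R : realType) (n : nat) (xi : R) : R :=
  (Num.sqrt (Num.sqrt pi * 2 ^+ n * n`!%:R))^-1
    * (hermite R n).[xi] * expR (- xi ^+ 2 / 2).

(* The Lebesgue integral of psi_n over the whole real line. *)
Definition psi_int (R : realType) (n : nat) : R :=
  \int[lebesgue_measure]_xi psi n xi.

Definition grid_step (R : realType) (ell : R) (Nx : nat) : R := ell / Nx%:R.

(* Periodic trapezoidal rule on [0, ell], for a function given by its values
   at the Nx grid nodes. *)
Definition trapz (R : realType) (ell : R) (Nx : nat) (g : 'I_Nx -> R) : R :=
  grid_step ell Nx * \sum_j g j.

Definition hadamard (R : realType) (n : nat) (a b : 'cV[R]_n) : 'cV[R]_n :=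
  \col_j (a j 0 * b j 0).

(* d_k for 1 <= k <= r, where r is half the order of the scheme. *)
Definition fd_weight (R : realType) (dx : R) (r k : nat) : R :=
  dx^-1 * ((-1) ^+ k.+1 * (r`!%:R) ^+ 2)
    / (k%:R * (r - k)`!%:R * (r + k)`!%:R).

(* d_k for 0 <= k < Nx.  Both tests fail at k = 0, and they exclude each other,
   as soon as p < Nx. *)
Definition fd_coef (R : realType) (dx : R) (Nx p k : nat) : R :=
  if (0 < k <= p./2)%N then fd_weight dx p./2 k
  else if (0 < Nx - k <= p./2)%N then - fd_weight dx p./2 (Nx - k)
  else 0.

(* Nx - j + k represents k - j modulo Nx, without truncation since j < Nx. *)
Definition fd_mx (R : realType) (ell : R) (Nx p : nat) : 'M[R]_Nx :=
  \matrix_(j < Nx, k < Nx)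
    fd_coef (grid_step ell Nx) Nx p ((Nx - j + k) %% Nx).

(* The Penrose equations over the reals. *)
Definition is_mp_pinv (R : realType) (m n : nat) (A : 'M[R]_(m, n))
    (B : 'M[R]_(n, m)) : Prop :=
  [/\ A *m B *m A = A, B *m A *m B = B,
      (A *m B)^T = A *m B & (B *m A)^T = B *m A].

(* Moore-Penrose pseudoinverse; MathComp's pinvmx is only a one-sided inverse
   on a row space. *)
Definition mp_pinv (R : realType) (m n : nat) (A : 'M[R]_(m, n)) :
    'M[R]_(n, m) :=
  xget 0 [set B | is_mp_pinv A B].

Lemma gram_unitmx (R : realType) (m n : nat) (A : 'M[R]_(m, n)) :
  row_free A -> A *m A^T \in unitmx.
Proof.
move=> fA; rewrite -row_free_unit; apply/inj_row_free => v vG.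
pose w := v *m A; have ww : (w *m w^T) 0 0 = 0.
  by rewrite trmx_mul /w mulmxA -(mulmxA v) vG mul0mx mxE.
suff w0 : w = 0 by apply/eqP; rewrite -(mulmx_free_eq0 v fA) -/w w0.
move/eqP: ww; rewrite mxE psumr_eq0; last first.
  by move=> j _; rewrite [_^T _ _]mxE -expr2 sqr_ge0.
move=> /allP w0; apply/rowP => j; have := w0 j (mem_index_enum j).
by rewrite /= [_^T _ _]mxE mulf_eq0 orbb => /eqP ->; rewrite [RHS]mxE.
Qed.

Lemma mp_pinvP (R : realType) (m n : nat) (A : 'M[R]_(m, n)) :
  is_mp_pinv A (mp_pinv A).
Proof.
suff [B AB] : exists B, is_mp_pinv A B
  by exact: (xgetI (P := is_mp_pinv A) 0 AB).
suff fullrank r (P : 'M[R]_(m, r)) (Q : 'M[R]_(r, n)) :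
    row_full P -> row_free Q -> exists B, is_mp_pinv (P *m Q) B.
  by rewrite -(mulmx_base A); apply: fullrank;
     [exact: col_base_full|exact: row_base_free].
move=> fP fQ; have uQ := gram_unitmx fQ.
have uP : P^T *m P \in unitmx.
  rewrite -[X in _ *m X]trmxK; apply: gram_unitmx.
  by rewrite /row_free mxrank_tr.
pose Qp := Q^T *m invmx (Q *m Q^T); pose Pp := invmx (P^T *m P) *m P^T.
have QQ : Q *m Qp = 1%:M by rewrite mulmxA mulmxV.
have PP : Pp *m P = 1%:M by rewrite -mulmxA mulVmx.
have AB : (P *m Q) *m (Qp *m Pp) = P *m Pp.
  by rewrite mulmxA -(mulmxA P) QQ mulmx1.
have BA : (Qp *m Pp) *m (P *m Q) = Qp *m Q.
  by rewrite mulmxA -(mulmxA Qp) PP mulmx1.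
exists (Qp *m Pp); split.
- by rewrite AB mulmxA -(mulmxA P) PP mulmx1.
- by rewrite BA mulmxA -(mulmxA Qp) QQ mulmx1.
- by rewrite AB /Pp !trmx_mul trmx_inv trmx_mul !trmxK mulmxA.
- by rewrite BA /Qp !trmx_mul trmx_inv trmx_mul !trmxK mulmxA.
Qed.

Definition prev_mode (R : realType) (Nx : nat) (c : nat -> 'cV[R]_Nx) (n : nat)
    : 'cV[R]_Nx :=
  if n is k.+1 then c k else 0.

Definition next_mode (R : realType) (Nx Nv : nat) (c : nat -> 'cV[R]_Nx)
    (n : nat) : 'cV[R]_Nx :=
  if (n.+1 < Nv)%N then c n.+1 else 0.

(* Right-hand side of the evolution equation of mode n of one species, at a
   fixed time, with coefficients c and electric field e. *)
Definition sw_rhs (R : realType) (q u m alpha ell : R) (Nx Nv p : nat)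
    (c : nat -> 'cV[R]_Nx) (e : 'cV[R]_Nx) (n : nat) : 'cV[R]_Nx :=
  - (fd_mx ell Nx p *m
      ((alpha * Num.sqrt (n%:R / 2)) *: prev_mode c n
       + (alpha * Num.sqrt (n.+1%:R / 2)) *: next_mode Nv c n
       + u *: c n))
  + (q / (m * alpha)) *:
      hadamard e (Num.sqrt (n%:R / 2) *: prev_mode c n
                  - Num.sqrt (n.+1%:R / 2) *: next_mode Nv c n).

Definition sw_charge (R : realType) (S : finType) (q alpha : S -> R)
    (Nx Nv : nat) (c : S -> nat -> 'cV[R]_Nx) : 'cV[R]_Nx :=
  \sum_s (q s * alpha s) *: \sum_(n < Nv) psi_int R n *: c s n.

(* C s n t and E t are the coefficient vectors and the field on a set J of
   times; C s n is only meaningful for n < Nv.  For Nx even the kernel of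
   fd_mx is spanned by the constants and the sawtooth (-1)^j, so that the
   Poisson equation and the zero mean leave the sawtooth component of E free at
   each time: sw_sawtooth is the normalization which makes E the (minimum norm)
   solution.  It is void for Nx odd, where the first two determine E. *)
Record sw_solution (R : realType) (S : finType) (q u m alpha : S -> R)
    (ell : R) (Nx Nv p : nat) (J : set R)
    (C : S -> nat -> R -> 'cV[R]_Nx) (E : R -> 'cV[R]_Nx) : Prop := SwSolution {
  sw_vlasov : forall (s : S) (n : nat) (t : R), (n < Nv)%N -> J t ->
    is_derive t 1 (C s n)
      (sw_rhs (q s) (u s) (m s) (alpha s) ell Nv p
         (fun k => C s k t) (E t) n);
  sw_poisson : forall t : R, J t ->
    fd_mx ell Nx p *m E t = sw_charge q alpha Nv (fun s k => C s k t);
  sw_zero_mean : forall t : R, J t -> trapz ell (fun j => E t j 0) = 0;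
  sw_sawtooth : ~~ odd Nx -> forall t : R, J t ->
    \sum_(j < Nx) (-1) ^+ j * E t j 0 = 0
}.

(* f_sw^s at the grid node x^(j). *)
Definition f_sw (R : realType) (S : finType) (u alpha : S -> R) (Nx Nv : nat)
    (C : S -> nat -> R -> 'cV[R]_Nx) (s : S) (j : 'I_Nx) (v t : R) : R :=
  \sum_(n < Nv) C s n t j 0 * psi n ((v - u s) / alpha s).

Definition kinetic_energy (R : realType) (S : finType) (u m alpha : S -> R)
    (ell : R) (Nx Nv : nat) (C : S -> nat -> R -> 'cV[R]_Nx) (t : R) : R :=
  2^-1 * \sum_s m s * trapz ell (fun j : 'I_Nx =>
    \int[lebesgue_measure]_v (v ^+ 2 * f_sw u alpha Nv C s j v t)).

Definition potential_energy (R : realType) (ell : R) (Nx : nat)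
    (E : R -> 'cV[R]_Nx) (t : R) : R :=
  2^-1 * trapz ell (fun j => E t j 0 ^+ 2).

Definition total_energy (R : realType) (S : finType) (u m alpha : S -> R)
    (ell : R) (Nx Nv : nat) (C : S -> nat -> R -> 'cV[R]_Nx)
    (E : R -> 'cV[R]_Nx) (t : R) : R :=
  kinetic_energy u m alpha ell Nv C t + potential_energy ell E t.

(* Main.v *)
Require Import Defs.
From mathcomp Require Import all_boot all_order all_algebra.
From mathcomp Require Import all_classical all_reals all_analysis.
From mathcomp Require Import measurable_realfun.
From mathcomp Require Import ring lra zify.
Import Order.TTheory GRing.Theory Num.Theory.
Import numFieldNormedType.Exports.
Local Open Scope classical_set_scope.
Local Open Scope ring_scope.

(** The energy balance comes from three independent facts.

    Space.  Write T for the cyclic shift of the grid.  The centered difference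
    matrix factors as D = dx^-1 T^-1 (T^2 - 1) Q with
    Q = sum_(k < r) b_k A^k, where A = (1 - T)(1 - T^-1) is the nonnegative
    discrete Laplacian, r = p/2 and every b_k is positive ([fd_mx_factor]).
    Since b_0 > 0, Q is injective, so the kernel of D is the set of 2-periodic
    grid functions: the constants and, for an even number of nodes, the
    sawtooth.  The field E is orthogonal to these, hence D^+ D E = E
    ([mp_pinv_fd_mxK]); in particular E = D^+ rho is differentiable in time.
    Moreover the columns of D sum to zero ([sum_fd_mx_mul]), so that transport
    does not contribute to the kinetic energy.

    Velocity.  Each psi_n is a polynomial times w = exp(-xi^2/2), and the only
    analytic input is that the integral of (P w)' vanishes for every polynomial
    P ([gauss_int_by_parts]).  Combined with the ladder relations for xi psi_n
    and psi_n', it determines the moments of order at most two through the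
    integrals I_n, shows that I_n = 0 for odd n, and gives
      l_(n+1) W_(n+1) - l_n W_(n-1) = 2 alpha A_n,   l_n = sqrt (n / 2),
    where A_n and W_n are the moments of alpha xi + u and of its square
    against psi_n ([energy_weight_ladder]).

    Balance.  Sum the mode equations against W_n and against I_n.  Summation by
    parts over n turns the coupling between neighbouring modes into the
    discrete derivatives above plus one boundary term from the truncation at
    n = Nv.  The kinetic energy gains E . j, with j the current, minus a
    boundary term; the charge obeys rho' = - D j - (boundary term), so that
    E . E' = E . D^+ rho' loses the same E . j.  Only the boundary terms
    survive.  They carry the factors l_Nv W_Nv and l_Nv I_Nv, and the parity of
    Nv decides which of I_Nv and I_(Nv-1) vanishes. *)

(** * The cyclic shift and the finite difference coefficients *)

Definition shift_mx (R : realType) (n : nat) : 'M[R]_n.+1 :=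
  \matrix_(j, k) (k == (j.+1 %% n.+1)%N :> nat)%:R.

Lemma shift_mx_mul (R : realType) n k (A : 'M[R]_(n.+1, k)) i j :
  (shift_mx R n *m A) i j = A (ordS i) j.
Proof.
rewrite mxE (bigD1 (ordS i))//= big1 ?addr0; last first.
  move=> l li; rewrite mxE (_ : (_ == _ :> nat) = false) ?mul0r//.
  by apply/negbTE; apply: contra li => /eqP li; apply/eqP/val_inj.
by rewrite mxE eqxx mul1r.
Qed.

Lemma shift_mxX (R : realType) n i (j k : 'I_n.+1) :
  (shift_mx R n ^+ i) j k = (k == ((j + i) %% n.+1)%N :> nat)%:R.
Proof.
elim: i j => [|i IH] j.
  by rewrite expr0 mxE addn0 modn_small// eq_sym.
rewrite exprS -[_ * _]/(_ *m _) shift_mx_mul IH /=.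
by rewrite modnDml addSnnS.
Qed.

Lemma shift_mx_tr (R : realType) n : shift_mx R n * (shift_mx R n)^T = 1.
Proof.
apply/matrixP => i j; rewrite -[_ * _]/(_ *m _) shift_mx_mul !mxE.
by congr (_%:R); rewrite -(inj_eq (can_inj (@ordSK n.+1))).
Qed.

Lemma comm_shift_mx_tr (R : realType) n :
  GRing.comm (shift_mx R n) (shift_mx R n)^T.
Proof.
by rewrite /GRing.comm shift_mx_tr; exact/esym/(mulmx1C (shift_mx_tr R n)).
Qed.

Lemma natr_mul_bin_left (R : realType) (n k : nat) :
  k.+1%:R * 'C(n, k.+1)%:R = (n%:R - k%:R) * 'C(n, k)%:R :> R.
Proof.
have [kn|nk] := leqP k n; first by rewrite -natrB// -!natrM mul_bin_left.
by rewrite !bin_small ?mulr0 // ltnW.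
Qed.

Lemma central_binS (r : nat) :
  (r.+1 * 'C(r.+1.*2, r.+1) = 2 * r.*2.+1 * 'C(r.*2, r))%N.
Proof.
have h1 := mul_bin_diag r.+1.*2 r; have h2 := mul_bin_down r.*2.+1 r.
rewrite /= in h1 h2.
have e : (r.*2.+1 - r = r.+1)%N by lia.
by rewrite e in h2; rewrite -h1 -mulnA h2 doubleS /= mulnA; congr muln; lia.
Qed.

(** The finite difference stencil multiplied by X^r, so that it becomes the
    coefficient sequence of a polynomial.  Writing the weights with binomial
    coefficients makes them vanish outside the stencil, and the total division
    gives the central coefficient 0 / 0 = 0. *)
Definition fd_numer_coef (R : realType) (r i : nat) : R :=
  (-1) ^+ (i + r).+1 * 'C(r.*2, i)%:R / ('C(r.*2, r)%:R * (i%:R - r%:R)).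

(** The coefficient by which the stencil of order 2 (r + 1) corrects the one of
    order 2 r, see [fd_numerS]. *)
Definition fd_laplacian_coef (R : realType) (r : nat) : R :=
  (2 * r.*2.+1%:R * 'C(r.*2, r)%:R)^-1.

Lemma fd_laplacian_coef_gt0 (R : realType) r : 0 < fd_laplacian_coef R r.
Proof.
by rewrite invr_gt0 !mulr_gt0// ltr0n bin_gt0 -addnn leq_addr.
Qed.

(** The coefficientwise form of [fd_numerS] for three consecutive binomial
    coefficients a, b, c of row 2 r, where x is the index of c.  The two
    hypotheses relate neighbouring entries without dividing by x or x - 1, which
    keeps the boundary indices 0 and 1 inside the general case. *)
Lemma fd_rec_arith (F : realType) (r x z a b c : F) :
  z != 0 -> r + 1 != 0 -> 2 * r + 1 != 0 ->
  x * c = (2 * r - x + 1) * b -> (x - 1) * b = (2 * r - x + 2) * a ->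
  (c + 2 * b + a) / ((r + 1)^-1 * (2 * (2 * r + 1) * z) * (x - (r + 1)))
  = b / (z * (x - 1 - r)) + (2 * (2 * r + 1) * z)^-1 * (a - c).
Proof.
move=> z0 r0 r1 xc xb; have [xr|xr] := eqVneq x (r + 1).
  have -> : c = a by apply: (mulfI r0); rewrite xr in xc xb; lra.
  by rewrite xr subrr addrK subrr !mulr0 !invr0 !mulr0 subrr mulr0 addr0.
have d0 : x - (r + 1) != 0 by rewrite subr_eq0.
have -> : x - 1 - r = x - (r + 1) by ring.
apply/eqP; rewrite -subr_eq0; apply/eqP.
transitivity ((x * c - 2 * r * b + (2 * r + 2 - x) * a)
    / (2 * (2 * r + 1) * z * (x - (r + 1)))).
  by field; rewrite r0 z0 r1 d0.
have -> : x * c - 2 * r * b + (2 * r + 2 - x) * a = 0 by lra.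
by rewrite mul0r.
Qed.

Definition fd_numer (R : realType) (r : nat) : {poly R} :=
  \poly_(i < r.*2.+1) fd_numer_coef R r i.

Lemma coef_fd_numer (R : realType) r i :
  (fd_numer R r)`_i = fd_numer_coef R r i.
Proof.
rewrite coef_poly ltnS; case: leqP => // ri.
by rewrite /fd_numer_coef bin_small// mulr0 mul0r.
Qed.

Lemma coef_exp1BX (R : realType) m k :
  ((1 - 'X) ^+ m : {poly R})`_k = (-1) ^+ k * 'C(m, k)%:R.
Proof.
elim: m k => [|m IH] k.
  by rewrite expr0 coef1 bin0n; case: k => [|k]; rewrite /= ?expr0 ?mulr1 ?mulr0.
rewrite exprS mulrBl mul1r coefB coefXM !IH; case: k => [|k] /=.
  by rewrite subr0 !bin0.
by rewrite binS natrD exprS; ring.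
Qed.

(** Raising the order by two adds one positive multiple of the central
    difference of a power of the Laplacian: multiplication by X^(r + 1) turns
    the product of X - X^-1 and (2 - X - X^-1)^r into that of X^2 - 1 and
    (-1)^r (1 - X)^(2 r).  Induction on r then exhibits the sign of the symbol,
    which the alternating weights hide. *)
Lemma fd_numerS (R : realType) r :
  fd_numer R r.+1 = 'X * fd_numer R r
    + ((-1) ^+ r * fd_laplacian_coef R r) *: (('X^2 - 1) * (1 - 'X) ^+ r.*2).
Proof.
have z0 : 'C(r.*2, r)%:R != 0 :> R.
  by rewrite pnatr_eq0 -lt0n bin_gt0 -addnn leq_addr.
have r0 : r%:R + 1 != 0 :> R by rewrite natr1 pnatr_eq0.
have r2E : r.*2%:R = 2 * r%:R :> R by rewrite -mul2n natrM.
have r1 : 2 * r%:R + 1 != 0 :> R by rewrite -r2E natr1 pnatr_eq0.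
have cS : 'C(r.+1.*2, r.+1)%:R
    = (r%:R + 1)^-1 * (2 * (2 * r%:R + 1) * 'C(r.*2, r)%:R) :> R.
  by apply: (mulfI r0); rewrite mulVKf// -r2E !natr1 -!natrM central_binS.
apply/polyP => i; rewrite coefD coefXM coefZ mulrBl mul1r coefB coefXnM.
rewrite !coef_fd_numer !coef_exp1BX.
rewrite /fd_numer_coef /fd_laplacian_coef {}cS -[r.+1%:R]natr1 -[r.*2.+1%:R]natr1 r2E.
have arith (x : R) a b c := @fd_rec_arith R r%:R x _ a b c z0 r0 r1.
case: i => [|[|j]] /=.
- have := arith 0 0 0 1; rewrite !mul0r !mulr0 sub0r !addr0 sub0r => /(_ erefl).
  move=> /(_ erefl) E.
  rewrite !bin0 addnS exprS add0n sub0r mulr1 add0r.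
  set x := (X in _ = X) in E.
  transitivity ((-1) ^+ r * x); last by rewrite /x expr0; ring.
  by rewrite -E exprS; ring.
- have := arith 1 0 1 (2 * r%:R); rewrite subrr !mul0r mulr0 => E.
  have {}E := E (ltac:(ring)) erefl.
  rewrite doubleS !binS !bin0 bin1 r2E !natrD r2E.
  rewrite !addSn !add0n.
  set x := (X in _ = X) in E.
  transitivity (- (-1) ^+ r * x); last by rewrite /x !exprS expr0; ring.
  by rewrite -E !exprS; ring.
- have := natr_mul_bin_left R r.*2 j.+1; have := natr_mul_bin_left R r.*2 j.
  rewrite subn2/= doubleS !binS !natrD r2E -[j.+2%:R]natr1 -[j.+1%:R]natr1.
  move=> h1 h2; rewrite addSn addnS !addSn !exprS exprD.
  have := arith (j%:R + 1 + 1) 'C(r.*2, j)%:R 'C(r.*2, j.+1)%:R 'C(r.*2, j.+2)%:R.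
  have -> : j%:R + 1 + 1 - 1 = j%:R + 1 :> R by ring.
  rewrite h1 h2 => E.
  have {}E := E (ltac:(ring)) (ltac:(ring)).
  set x := (X in _ = X) in E.
  transitivity ((-1) ^+ j * (-1) ^+ r * x); last by rewrite /x; ring.
  by rewrite -E; ring.
Qed.

Lemma central_bin_ratio (R : realType) (r k : nat) : (k <= r)%N ->
  'C(r.*2, r + k)%:R / 'C(r.*2, r)%:R
  = r`!%:R ^+ 2 / ((r - k)`!%:R * (r + k)`!%:R) :> R.
Proof.
move=> kr.
have fact0 n : n`!%:R != 0 :> R by rewrite pnatr_eq0 -lt0n fact_gt0.
have C0 : 'C(r.*2, r)%:R != 0 :> R.
  by rewrite pnatr_eq0 -lt0n bin_gt0 -addnn leq_addr.
apply/eqP; rewrite eqr_div ?mulf_neq0//; apply/eqP.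
have rkr : (r + k <= r.*2)%N by lia.
have rr : (r <= r.*2)%N by lia.
have := bin_fact rkr; have := bin_fact rr.
rewrite (_ : r.*2 - (r + k) = r - k)%N; last by lia.
rewrite (_ : r.*2 - r = r)%N; last by lia.
move=> e1 e2; rewrite expr2 -!natrM; congr (_%:R); rewrite mulnC in e2 *.
by rewrite [in RHS]mulnC e1 -e2; lia.
Qed.

(** The index shift by r turns the two symmetric halves of the stencil, which
    wrap around modulo Nx, into the single range 0..2 r. *)
Lemma fd_coefE (R : realType) (dx : R) (Nx r i : nat) :
  (r.*2 < Nx)%N -> (i < Nx)%N ->
  fd_coef dx Nx r.*2 ((i + (Nx - r)) %% Nx) = dx^-1 * fd_numer_coef R r i.
Proof.
move=> rN iN; rewrite /fd_coef /fd_numer_coef /fd_weight doubleK.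
have [ri|ir] := leqP r i.
  have -> : ((i + (Nx - r)) %% Nx = i - r)%N.
    rewrite (_ : i + (Nx - r) = i - r + Nx)%N; last by lia.
    by rewrite modnDr modn_small; lia.
  have [k iE] : exists k, i = (r + k)%N by exists (i - r)%N; lia.
  rewrite {}iE addKn in iN ri *.
  have [kr|rk] := leqP k r; last first.
    rewrite bin_small ?mulr0 ?mul0r ?mulr0; last by lia.
    by rewrite andbF ifF //; lia.
  have -> : (0 < Nx - k <= r)%N = false by lia.
  have [->|k0] := posnP k; first by rewrite /= addn0 subrr !mulr0 invr0 !mulr0.
  rewrite natrD [r%:R + _ - _]addrC addKr.
  have -> : (-1) ^+ (r + k + r).+1 = (-1) ^+ k.+1 :> R.
    by rewrite -signr_odd -[RHS]signr_odd; congr (_ ^+ nat_of_bool _); lia.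
  transitivity (dx^-1 * (-1) ^+ k.+1 / k%:R
                * ('C(r.*2, r + k)%:R / 'C(r.*2, r)%:R)).
    by rewrite (central_bin_ratio R r k kr) !invfM; ring.
  by rewrite !invfM; ring.
have -> : ((i + (Nx - r)) %% Nx = i + (Nx - r))%N by rewrite modn_small; lia.
have [k [iE kr]] : exists k, i = (r - k)%N /\ (0 < k <= r)%N.
  by exists (r - i)%N; lia.
rewrite {}iE in ir iN *.
have -> : (r - k + (Nx - r) <= r)%N = false by lia.
rewrite andbF (_ : (Nx - (r - k + (Nx - r)) = k)%N); last by lia.
rewrite kr; case/andP: kr => k0 kr.
rewrite natrB// (_ : r%:R - k%:R - r%:R = - k%:R :> R); last by ring.
rewrite -(@bin_sub r.*2); last by lia.
rewrite (_ : r.*2 - (r - k) = r + k)%N; last by lia.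
have -> : (-1) ^+ (r - k + r).+1 = (-1) ^+ k.+1 :> R.
  by rewrite -signr_odd -[RHS]signr_odd; congr (_ ^+ nat_of_bool _); lia.
transitivity (- (dx^-1 * (-1) ^+ k.+1 / k%:R
                * ('C(r.*2, r + k)%:R / 'C(r.*2, r)%:R))).
  by rewrite (central_bin_ratio R r k kr) !invfM; ring.
by rewrite !invfM invrN; ring.
Qed.

(** * Factorization and kernel of the difference matrix *)

Definition shift_laplacian (F : realType) (n : nat) : 'M[F]_n.+1 :=
  (1 - shift_mx F n) * (1 - (shift_mx F n)^T).

Lemma comm_shift_laplacian (R : realType) n :
  GRing.comm (shift_mx R n) (shift_laplacian R n).
Proof.
by apply: commrM; apply: commrB; try exact: commr1; [|exact: comm_shift_mx_tr].
Qed.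

Definition fd_laplacian_poly (R : realType) (n r : nat) : 'M[R]_n.+1 :=
  \sum_(k < r) fd_laplacian_coef R k *: shift_laplacian R n ^+ k.

(** [fd_numerS] evaluated at the shift, where T A = - (1 - T)^2 for the
    Laplacian A.  The extra factor T on the left absorbs the exponent r - 1. *)
Lemma horner_shift_numer (R : realType) (n r : nat) :
  let T := shift_mx R n in
  T * horner_mx T (fd_numer R r) = T ^+ r * (T ^+ 2 - 1) * fd_laplacian_poly R n r.
Proof.
move=> T; have TT : T * T^T = 1 by exact: shift_mx_tr.
have TA : T * shift_laplacian R n = - (1 - T) ^+ 2.
  rewrite /shift_laplacian -/T mulrA [T * (1 - T)]mulrBr mulr1.
  rewrite mulrBl !mulrBr TT !mulr1 -mulrA TT mulr1.
  by rewrite expr2 mulrBr mulrBl mul1r mulr1 mulrBl mul1r !opprB addrC.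
have cTA : GRing.comm T (shift_laplacian R n) by exact: comm_shift_laplacian.
have TAk k : T ^+ k * shift_laplacian R n ^+ k = (-1) ^+ k * (1 - T) ^+ k.*2.
  rewrite -(exprMn_comm k cTA) TA -mulN1r exprMn_comm; last exact/commr_sym/commrN1.
  by rewrite -exprM mul2n.
elim: r => [|r IH].
  rewrite /fd_laplacian_poly big_ord0 mulr0 (_ : fd_numer R 0 = 0) ?rmorph0 ?mulr0//.
  apply/polyP => i; rewrite coef_fd_numer coef0 /fd_numer_coef.
  by case: i => [|i]; [rewrite subrr mulr0 invr0 mulr0|rewrite bin0n mulr0 mul0r].
rewrite fd_numerS rmorphD/= rmorphM/= horner_mx_X linearZ/= mulrDr rmorphM/=.
rewrite rmorphB/= rmorphXn/= horner_mx_X rmorph1 rmorphXn/= rmorphB/=.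
rewrite rmorph1 horner_mx_X.
rewrite IH [(-1) ^+ r * _]mulrC -scalerA.
have -> : (-1) ^+ r *: ((T ^+ 2 - 1) * (1 - T) ^+ r.*2)
    = (T ^+ 2 - 1) * (T ^+ r * shift_laplacian R n ^+ r).
  rewrite TAk scalerAr; congr (_ * _).
  by rewrite -signr_odd -[in RHS]signr_odd; case: odd;
     rewrite ?expr1 ?scaleN1r ?mulN1r// !expr0 scale1r mul1r.
have -> : fd_laplacian_poly R n r.+1 = fd_laplacian_poly R n r
    + fd_laplacian_coef R r *: shift_laplacian R n ^+ r.
  by rewrite /fd_laplacian_poly big_ord_recr.
rewrite [_ * (fd_laplacian_poly _ _ _ + _)]mulrDr [T ^+ r.+1]exprS !mulrA.
congr (_ + _).
rewrite -!scalerAr !mulrA; congr (_ *: (_ * _)).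
rewrite -!mulrA; congr (_ * _).
apply: commr_sym; apply: commrB; last exact: commr1.
by apply: commrX; exact: commr_sym (commrX _ _).
Qed.

Lemma horner_mx_shiftE (R : realType) (n : nat) (P : {poly R}) (j k : 'I_n.+1) :
  (size P <= n.+1)%N ->
  horner_mx (shift_mx R n) P j k = P`_((k + (n.+1 - j)) %% n.+1).
Proof.
move=> sP; set i := (_ %% _)%N; have iN : (i < n.+1)%N by rewrite ltn_mod.
have {1}-> : P = \poly_(l < n.+1) P`_l.
  apply/polyP => l; rewrite coef_poly; case: ltnP => // nl.
  by rewrite nth_default// (leq_trans sP).
have shiftP (l : nat) : (l < n.+1)%N ->
    (k == (j + l) %% n.+1 :> nat)%N = (l == i).
  move=> ln; have jn := ltn_ord j; have kn := ltn_ord k; rewrite /i.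
  have [jln|jln] := ltnP (j + l) n.+1; have [jk|jk] := leqP j k.
  - rewrite modn_small// (_ : k + (n.+1 - j) = k - j + n.+1)%N; last by lia.
    by rewrite modnDr modn_small; lia.
  - by rewrite modn_small// modn_small; lia.
  - rewrite (_ : j + l = j + l - n.+1 + n.+1)%N; last by lia.
    rewrite modnDr modn_small; last by lia.
    rewrite (_ : k + (n.+1 - j) = k - j + n.+1)%N; last by lia.
    by rewrite modnDr modn_small; lia.
  - rewrite (_ : j + l = j + l - n.+1 + n.+1)%N; last by lia.
    rewrite modnDr modn_small; last by lia.
    by rewrite modn_small; lia.
rewrite poly_def linear_sum summxE (bigD1 (Ordinal iN))//= big1 ?addr0 => [|l li].
  by rewrite linearZ/= rmorphXn/= horner_mx_X mxE shift_mxX shiftP// eqxx mulr1.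
rewrite linearZ/= rmorphXn/= horner_mx_X mxE shift_mxX shiftP//.
by rewrite (_ : (_ == _ :> nat) = false) ?mulr0//; exact/negbTE.
Qed.

Lemma fd_mx_factor (R : realType) (ell : R) (n r : nat) : (r.*2 < n.+1)%N ->
  let T := shift_mx R n in
  fd_mx ell n.+1 r.*2
    = (grid_step ell n.+1)^-1 *: (T^T * (T ^+ 2 - 1) * fd_laplacian_poly R n r).
Proof.
move=> rn T; have TT : T^T * T = 1 by exact: mulmx1C (shift_mx_tr R n).
have TTr k : T^T ^+ k * T ^+ k = 1.
  rewrite -exprMn_comm ?TT ?expr1n//.
  exact/commr_sym/comm_shift_mx_tr.
have TrD : T ^+ r * fd_mx ell n.+1 r.*2
    = (grid_step ell n.+1)^-1 *: horner_mx T (fd_numer R r).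
  apply/matrixP => j k; rewrite !mxE horner_mx_shiftE; last first.
    exact: leq_trans (size_poly _ _) _.
  have jrn : ((j + r) %% n.+1 < n.+1)%N by rewrite ltn_mod.
  rewrite (bigD1 (Ordinal jrn))//= big1 ?addr0; last first.
    move=> l lj; rewrite shift_mxX (_ : (_ == _ :> nat) = false) ?mul0r//.
    by apply/negbTE; apply: contra lj => /eqP lj; apply/eqP/val_inj.
  rewrite shift_mxX/= eqxx mul1r mxE coef_fd_numer/= -(fd_coefE _ _ n.+1)//; last first.
    by rewrite ltn_mod.
  congr (fd_coef _ _ _ _).
  rewrite modnDml; have jn := ltn_ord j; have kn := ltn_ord k.
  have [jrs|jrs] := ltnP (j + r) n.+1.
    rewrite (modn_small jrs) (_ : k + (n.+1 - j) + (n.+1 - r) =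
      n.+1 - (j + r) + k + n.+1)%N; last by lia.
    by rewrite modnDr.
  rewrite (_ : (j + r) = (j + r - n.+1) + n.+1)%N; last by lia.
  rewrite modnDr (modn_small (_ : j + r - n.+1 < n.+1)%N); last by lia.
  by congr modn; lia.
apply: (can_inj (mulKr (_ : T ^+ r \is a GRing.unit))).
  by apply/unitrP; exists (T^T ^+ r); split=> //; apply: mulmx1C; exact: TTr.
rewrite TrD -scalerAr; congr (_ *: _).
have TU : T \is a GRing.unit.
  by apply/unitrP; exists T^T; split=> //; exact: shift_mx_tr.
apply: (can_inj (mulKr TU)); rewrite horner_shift_numer -/T !mulrA -exprS.
rewrite [T ^+ r.+1]exprSr -!mulrA; congr (_ * _).
by rewrite [RHS]mulrA (shift_mx_tr R n : T * T^T = 1) mul1r.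
Qed.

Lemma trmx_mul_self_ge0 (R : realType) (n : nat) (x : 'cV[R]_n) :
  0 <= (x^T *m x) 0 0.
Proof. by rewrite mxE sumr_ge0// => i _; rewrite mxE -expr2 sqr_ge0. Qed.

Lemma trmx_mul_self_eq0 (R : realType) (n : nat) (x : 'cV[R]_n) :
  (x^T *m x) 0 0 = 0 -> x = 0.
Proof.
move=> /eqP; rewrite mxE psumr_eq0 => [/allP x0|i _]; last first.
  by rewrite mxE -expr2 sqr_ge0.
apply/colP => i; have := x0 i (mem_index_enum i).
by rewrite /= !mxE mulf_eq0 orbb => /eqP.
Qed.

(** With B = 1 - T, which is normal, A^k = B^k (B^k)^T. *)
Lemma shift_laplacian_exp_ge0 (R : realType) (n k : nat) (x : 'cV[R]_n.+1) :
  0 <= (x^T *m (shift_laplacian R n ^+ k *m x)) 0 0.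
Proof.
rewrite /shift_laplacian; set T := shift_mx R n; set B := 1 - T.
have BT : 1 - T^T = B^T by rewrite /B linearB/= trmx1.
have cB : GRing.comm B B^T.
  rewrite -BT; apply: commrB; first exact: commr1.
  apply: commr_sym; apply: commrB; first exact: commr1.
  exact/commr_sym/comm_shift_mx_tr.
rewrite BT exprMn_comm//.
have -> : B^T ^+ k = (B ^+ k)^T.
  by elim: k => [|k IH]; rewrite ?expr0 ?trmx1// exprS IH exprSr; exact/esym/trmx_mul.
have := trmx_mul_self_ge0 R n.+1 ((B ^+ k)^T *m x).
by rewrite trmx_mul trmxK -!mulmxA.
Qed.

(** The quadratic form of the matrix is at least its first coefficient times
    the squared norm, because the higher powers of A contribute nonnegatively. *)
Lemma fd_laplacian_poly_inj (R : realType) (n r : nat) (x : 'cV[R]_n.+1) : (0 < r)%N ->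
  fd_laplacian_poly R n r *m x = 0 -> x = 0.
Proof.
case: r => // r _ Qx; apply: trmx_mul_self_eq0; apply/eqP.
rewrite eq_le trmx_mul_self_ge0 andbT.
rewrite -(pmulr_rle0 _ (fd_laplacian_coef_gt0 R 0)).
have : (x^T *m (fd_laplacian_poly R n r.+1 *m x)) 0 0 = 0 by rewrite Qx mulmx0 mxE.
rewrite /fd_laplacian_poly big_ord_recl/= expr0 mulmxDl mulmxDr mxE => /eqP.
rewrite -scalemxAl mul1mx -scalemxAr mxE addr_eq0 => /eqP ->.
rewrite oppr_le0 mulmx_suml mulmx_sumr summxE sumr_ge0// => i _.
rewrite -scalemxAl -scalemxAr mxE mulr_ge0//; first exact/ltW/fd_laplacian_coef_gt0.
exact: shift_laplacian_exp_ge0.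
Qed.

Lemma fd_mx_factorC (R : realType) (ell : R) (n r : nat) : (r.*2 < n.+1)%N ->
  let T := shift_mx R n in
  fd_mx ell n.+1 r.*2
    = (grid_step ell n.+1)^-1 *: (T^T * fd_laplacian_poly R n r * (T ^+ 2 - 1)).
Proof.
move=> rn T; rewrite fd_mx_factor// -/T -!mulrA; congr (_ *: (_ * _)).
apply: commr_sym; apply: commrB; last exact: commr1.
apply: commrX; apply: commr_sym; rewrite /GRing.comm mulr_sumr mulr_suml.
apply: eq_bigr => k _; rewrite -scalerAl -scalerAr; congr (_ *: _).
exact/commrX/comm_shift_laplacian.
Qed.

Lemma shift_sqr_fixed_of_ker (R : realType) (ell : R) (n r : nat) (x : 'cV[R]_n.+1) :
  0 < ell -> (0 < r)%N -> (r.*2 < n.+1)%N ->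
  fd_mx ell n.+1 r.*2 *m x = 0 -> forall j, x (ordS (ordS j)) 0 = x j 0.
Proof.
move=> ell0 r0 rn; rewrite fd_mx_factorC//; set T := shift_mx R n.
have dx0 : (grid_step ell n.+1)^-1 != 0.
  by rewrite invr_eq0 mulf_neq0 ?gt_eqF// invr_gt0.
rewrite -scalemxAl -!mulmxA => /eqP; rewrite scaler_eq0 (negbTE dx0)/= => /eqP.
move/(congr1 (mulmx T)); rewrite mulmxA (shift_mx_tr R n : T *m T^T = 1) mul1mx.
rewrite mulmx0 => /(fd_laplacian_poly_inj _ _ _ _ r0) Tx j.
have := congr1 (fun y : 'cV[R]_n.+1 => y j 0) Tx.
rewrite mulmxBl mul1mx mxE [X in _ + X]mxE [RHS]mxE -[T ^+ 2]/(T *m T).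
by rewrite -mulmxA !shift_mx_mul => /eqP; rewrite subr_eq0 => /eqP.
Qed.

(** A function on Z / N of period 2 is constant for N odd, as 2 generates
    Z / N, and a combination of 1 and (-1)^j for N even; in both cases it is
    orthogonal to itself. *)
Lemma shift_sqr_fixed_eq0 (R : realType) (n : nat) (x : 'cV[R]_n.+1) :
  (forall j, x (ordS (ordS j)) 0 = x j 0) ->
  \sum_j x j 0 = 0 ->
  (~~ odd n.+1 -> \sum_(j < n.+1) (-1) ^+ j * x j 0 = 0) -> x = 0.
Proof.
move=> x2 sx sawx; pose g k := x (inord (k %% n.+1)) 0.
have gE (j : 'I_n.+1) : g j = x j 0 by rewrite /g modn_small// inord_val.
have gN k : g (k + n.+1)%N = g k by rewrite /g modnDr.
have g2 k : g k.+2 = g k.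
  rewrite /g -[RHS]x2; congr (x _ 0); apply/val_inj.
  rewrite /= !inordK ?ltn_mod//.
  have mS m : ((m %% n.+1).+1 %% n.+1 = m.+1 %% n.+1)%N.
    by rewrite -addn1 modnDml addn1.
  by rewrite !mS -addn2 -modnDml addn2.
have gd k m : g (m + k.*2)%N = g m.
  by elim: k => [|k IH]; rewrite ?addn0// doubleS !addnS g2.
have gS k : g k = g (odd k).
  by rewrite -[in LHS](odd_double_half k) gd.
have [n1|n0] := boolP (odd n.+1).
  have g01 : g 1%N = g 0%N.
    by rewrite -(gN 0%N) add0n [RHS]gS n1.
  have xc j : x j 0 = g 0%N by rewrite -gE gS; case: odd.
  move: sx; under eq_bigr do rewrite xc.
  rewrite sumr_const card_ord -mulr_natl => /eqP; rewrite mulf_eq0 pnatr_eq0/=.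
  by move=> /eqP g0; apply/colP => j; rewrite xc g0 mxE.
apply: trmx_mul_self_eq0; rewrite mxE.
pose a := (g 0%N + g 1%N) / 2; pose b := (g 0%N - g 1%N) / 2.
have xab (j : 'I_n.+1) : x j 0 = a + b * (-1) ^+ j.
  by rewrite -gE gS -signr_odd; case: odd; rewrite /a /b ?expr0 ?expr1; field.
(* |x|^2 = <a 1 + b saw, x> *)
transitivity (a * \sum_j x j 0 + b * \sum_(j < n.+1) (-1) ^+ j * x j 0).
  rewrite !mulr_sumr -big_split/=; apply: eq_bigr => j _.
  by rewrite mxE {1}xab; ring.
by rewrite sx sawx// !mulr0 addr0.
Qed.

Lemma fd_mx_fixed_ker (R : realType) (ell : R) (n r : nat) (x : 'cV[R]_n.+1) :
  (r.*2 < n.+1)%N -> (forall j, x (ordS (ordS j)) 0 = x j 0) ->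
  fd_mx ell n.+1 r.*2 *m x = 0.
Proof.
move=> rn x2; rewrite fd_mx_factorC// -scalemxAl -mulmxA mulmxBl mul1mx.
set T := shift_mx R n; suff -> : T ^+ 2 *m x = x by rewrite subrr mulmx0 scaler0.
by apply/colP => j; rewrite -[T ^+ 2]/(T *m T) -mulmxA !shift_mx_mul x2.
Qed.

(** The difference of both sides lies in the kernel of D.  It is orthogonal to
    the constants and to the sawtooth: e is by assumption, and D^+ D e is since
    the symmetric matrix D^+ D annihilates the kernel of D. *)
Lemma mp_pinv_fd_mxK (R : realType) (ell : R) (Nx p : nat) (e : 'cV[R]_Nx) :
  0 < ell -> ~~ odd p -> (0 < p)%N -> (p < Nx)%N ->
  \sum_j e j 0 = 0 -> (~~ odd Nx -> \sum_(j < Nx) (-1) ^+ j * e j 0 = 0) ->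
  mp_pinv (fd_mx ell Nx p) *m fd_mx ell Nx p *m e = e.
Proof.
case: Nx e => // n e ell0 p_even p0 pn se sawe.
have pE : p = p./2.*2 by rewrite even_halfK.
rewrite {}pE in p0 pn *; move: p./2 p0 pn => r r0 rn {p_even}.
have {r0} r0 : (0 < r)%N by rewrite -double_gt0.
set D := fd_mx _ _ _; have [D1 _ _ D4] := mp_pinvP D.
set P := mp_pinv D *m D in D4 *.
have PK (w : 'cV[R]_n.+1) : D *m w = 0 -> w^T *m (P *m e) = 0.
  move=> Dw; rewrite mulmxA -{1}D4 -trmx_mul /P -mulmxA Dw mulmx0.
  by rewrite trmx0 mul0mx.
apply/eqP; rewrite eq_sym -subr_eq0; apply/eqP; apply: shift_sqr_fixed_eq0.
- apply: (shift_sqr_fixed_of_ker R ell n r) => //.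
  by rewrite -/D mulmxBr /P !mulmxA D1 subrr.
- have D0 : D *m (const_mx 1 : 'cV[R]_n.+1) = 0.
    by apply: fd_mx_fixed_ker => // j; rewrite !mxE.
  have := congr1 (fun M : 'M[R]_1 => M 0 0) (PK _ D0); rewrite !mxE => h.
  under eq_bigr do rewrite 2!mxE.
  rewrite big_split/= se add0r sumrN -[RHS]oppr0; congr (- _); rewrite -[RHS]h.
  by apply: eq_bigr => j _; rewrite !mxE mul1r.
- move=> nodd.
  have sawP : D *m (\col_j (-1) ^+ j : 'cV[R]_n.+1) = 0.
    apply: fd_mx_fixed_ker => // j; rewrite !mxE -signr_odd -[RHS]signr_odd.
    congr (_ ^+ nat_of_bool _); rewrite /=.
    have oddm k : odd (k %% n.+1) = odd k by apply: odd_mod; exact: negbTE.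
    by rewrite oddm /= oddm /= negbK.
  have := congr1 (fun M : 'M[R]_1 => M 0 0) (PK _ sawP).
  rewrite !mxE => h.
  under eq_bigr do rewrite 2!mxE mulrBr.
  rewrite sumrB sawe// sub0r -[RHS]oppr0; congr (- _); rewrite -[RHS]h.
  by apply: eq_bigr => j _; rewrite !mxE.
Qed.

Lemma sum_fd_mx_mul (R : realType) (ell : R) (Nx p : nat) (x : 'cV[R]_Nx) :
  ~~ odd p -> (p < Nx)%N -> \sum_j (fd_mx ell Nx p *m x) j 0 = 0.
Proof.
case: Nx x => // n x p_even pn.
have pE : p = p./2.*2 by rewrite even_halfK.
rewrite {}pE in pn *; rewrite fd_mx_factor//; set T := shift_mx R n.
have sumT (y : 'cV[R]_n.+1) : \sum_j (T *m y) j 0 = \sum_j y j 0.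
  under eq_bigr do rewrite shift_mx_mul.
  by rewrite [RHS](reindex_inj (can_inj (@ordSK n.+1))).
have sumTT (y : 'cV[R]_n.+1) : \sum_j (T^T *m y) j 0 = \sum_j y j 0.
  by rewrite -(sumT (T^T *m y)) mulmxA (shift_mx_tr R n : T *m T^T = 1) mul1mx.
rewrite -scalemxAl -!mulmxA; under eq_bigr do rewrite mxE.
rewrite -mulr_sumr sumTT mulmxBl mul1mx.
under eq_bigr do rewrite mxE [X in _ + X]mxE.
by rewrite big_split/= sumrN -[T ^+ 2]/(T *m T) -mulmxA !sumT subrr mulr0.
Qed.

(** * Integrals of polynomials against the Gaussian weight *)

Definition gauss (R : realType) (x : R) : R := expR (- x ^+ 2 / 2).

Definition poly_gauss (R : realType) (P : {poly R}) (x : R) : R :=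
  P.[x] * gauss R x.

Lemma is_derive_gauss (R : realType) (x : R) :
  is_derive x (1 : R) (gauss R) (- x * gauss R x).
Proof.
have h : is_derive x (1 : R) (fun y : R => - y ^+ 2 / 2) (- x).
  have -> : (fun y : R => - y ^+ 2 / 2) = horner ((- 2^-1) *: 'X^2).
    by apply/funext => y; rewrite hornerZ hornerXn; field.
  apply: (is_derive_eq (is_derive_poly _ _)).
  by rewrite derivZ derivXn hornerZ hornerMn hornerXn; field.
by apply: (is_derive_eq (is_derive1_comp (is_derive_expR _) h)); rewrite mulrC.
Qed.

Lemma is_derive_poly_gauss (R : realType) (P : {poly R}) (x : R) :
  is_derive x (1 : R) (poly_gauss R P) (poly_gauss R (P^`() - 'X * P) x).
Proof.
have h := is_derive_gauss R x.
apply: (is_derive_eq (is_deriveM (is_derive_poly P x) h)) => //.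
by rewrite /poly_gauss !hornerE; rewrite /GRing.scale/=; ring.
Qed.

Lemma continuous_poly_gauss (R : realType) (P : {poly R}) :
  continuous (poly_gauss R P).
Proof.
move=> x; apply/differentiable_continuous/derivable1_diffP.
by have [] := is_derive_poly_gauss R P x.
Qed.

Lemma exprn_le_expR (R : realType) (k : nat) (y : R) :
  0 <= y -> y ^+ k <= k`!%:R * expR y.
Proof.
move=> y0; case: k => [|k].
  by rewrite expr0 mul1r -[leLHS]expR0 ler_expR.
rewrite mulrC -ler_pdivrMr ?ltr0n ?fact_gt0//.
by apply: le_trans (expR_ge1Dxn k y0); rewrite lerDr.
Qed.

(** Half of the exponent of the Gaussian weight is spent on dominating a
    polynomial; this is what remains. *)
Definition wide_gauss (R : realType) (x : R) : R := expR (- (x ^+ 2 / 4)).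

Lemma normr_exp_gauss_le (R : realType) (k : nat) (x : R) :
  `|x| ^+ k * gauss R x <= (1 + 4 ^+ k * k`!%:R) * wide_gauss R x.
Proof.
set y := x ^+ 2 / 4; have y0 : 0 <= y by rewrite divr_ge0// sqr_ge0.
have -> : gauss R x = expR (- y) * expR (- y).
  by rewrite -expRD /gauss /y; congr expR; field.
rewrite /wide_gauss mulrA ler_wpM2r ?expR_ge0//.
rewrite expRN ler_pdivrMr ?expR_gt0// mulrDl mul1r.
(* squaring the power makes it a power of x ^ 2, whatever the parity of k *)
have xk : `|x| ^+ k <= 1 + `|x| ^+ k * `|x| ^+ k.
  by set z := `|x| ^+ k; have := sqr_ge0 (z - 2^-1); nra.
apply: le_trans xk _; apply: lerD; first by rewrite -expR0 ler_expR.
rewrite -exprMn -expr2 real_normK ?num_real//.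
have -> : x ^+ 2 = 4 * y by rewrite /y; field.
by rewrite exprMn -mulrA ler_wpM2l ?exprn_ge0// exprn_le_expR.
Qed.

Lemma integrable_wide_gauss (R : realType) :
  lebesgue_measure.-integrable setT (EFin \o wide_gauss R).
Proof.
(* up to its normalization, the normal density of variance 2 *)
have s0 : Num.sqrt 2 != 0 :> R by rewrite gt_eqF// sqrtr_gt0.
have pk := normal_peak_gt0 s0.
have := @integrableZl _ _ _ lebesgue_measure setT measurableT
  (normal_peak (Num.sqrt 2))^-1 _ (integrable_normal_pdf 0 (Num.sqrt (2:R))).
congr (_.-integrable _ _); apply/funext => x /=.
rewrite normal_pdfE// -EFinM mulKf ?gt_eqF//.
rewrite /normal_fun /wide_gauss subr0 sqr_sqrtr//; congr (expR _)%:E.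
by rewrite -mulr_natr; field.
Qed.

Lemma poly_gauss_le (R : realType) (P : {poly R}) :
  exists2 c, 0 <= c & forall x, `|poly_gauss R P x| <= c * wide_gauss R x.
Proof.
pose c k : R := 1 + 4 ^+ k * k`!%:R.
have c0 k : 0 <= c k by rewrite addr_ge0// mulr_ge0// exprn_ge0.
exists (\sum_(k < size P) `|P`_k| * c k) => [|x].
  by rewrite sumr_ge0// => k _; rewrite mulr_ge0.
rewrite /poly_gauss horner_coef !mulr_suml.
apply: le_trans (ler_norm_sum _ _ _) _; apply: ler_sum => k _.
rewrite -mulrA normrM -mulrA ler_wpM2l// normrM normrX.
by rewrite [X in _ * X]ger0_norm ?expR_ge0// normr_exp_gauss_le.
Qed.

Lemma integrable_poly_gauss (R : realType) (P : {poly R}) :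
  lebesgue_measure.-integrable setT (EFin \o poly_gauss R P).
Proof.
have [c c0 Pc] := poly_gauss_le R P.
apply: (le_integrable measurableT _ _
    (integrableZl measurableT c (integrable_wide_gauss R))).
  apply/measurable_EFinP; apply: continuous_measurable_fun.
  exact: continuous_poly_gauss.
move=> x _; rewrite -EFinM !abse_EFin lee_fin.
by rewrite [leRHS]ger0_norm ?mulr_ge0 ?expR_ge0.
Qed.

(** The bound for 'X * P provides a spare factor |u n|^-1. *)
Lemma poly_gauss_cvg0 (R : realType) (P : {poly R}) (u : R^nat) :
  (forall n, `|u n| = n.+1%:R) ->
  poly_gauss R P (u n) @[n --> \oo] --> (0 : R).
Proof.
move=> un; have [c c0 Pc] := poly_gauss_le R ('X * P).
apply/norm_cvg0P; apply: (@squeeze_cvgr _ _ _ _ (cst 0) (fun n => c * harmonic n)).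
- apply: nearW => n /=; rewrite normr_ge0/= ler_pdivlMr ?ltr0n//.
  have := Pc (u n); rewrite /poly_gauss hornerM hornerX -mulrA normrM un mulrC.
  move=> /le_trans; apply; rewrite ler_piMr// -expR0 ler_expR oppr_le0.
  by rewrite divr_ge0// sqr_ge0.
- exact: cvg_cst.
- by rewrite -[0](mulr0 c); apply: cvgM; [exact: cvg_cst|exact: cvg_harmonic].
Qed.

Definition gauss_int (R : realType) (P : {poly R}) : R :=
  \int[lebesgue_measure]_x poly_gauss R P x.

Lemma gauss_intD (R : realType) (P Q : {poly R}) :
  gauss_int R (P + Q) = gauss_int R P + gauss_int R Q.
Proof.
rewrite /gauss_int -RintegralD//; try exact: integrable_poly_gauss.
by apply: eq_Rintegral => x _; rewrite /poly_gauss hornerD mulrDl.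
Qed.

Lemma gauss_intZ (R : realType) (c : R) (P : {poly R}) :
  gauss_int R (c *: P) = c * gauss_int R P.
Proof.
rewrite /gauss_int -RintegralZl//; last exact: integrable_poly_gauss.
by apply: eq_Rintegral => x _; rewrite /poly_gauss hornerZ mulrA.
Qed.

(** The derivative of P w is (P' - X P) w.  Its integral over [-a, a] is a
    difference of boundary values, which tends to zero as a grows, and it tends
    to the integral over the line by dominated convergence. *)
Lemma gauss_int_by_parts (R : realType) (P : {poly R}) :
  gauss_int R P^`() = gauss_int R ('X * P).
Proof.
apply/eqP; rewrite -subr_eq0 -mulN1r -gauss_intZ -gauss_intD scaleN1r; apply/eqP.
set Q := P^`() - 'X * P.
set f := EFin \o poly_gauss R Q.
pose a n : R := n.+1%:R; pose I n : set R := `[- a n, a n]%classic.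
have If : lebesgue_measure.-integrable setT f by exact: integrable_poly_gauss.
have mf : measurable_fun setT f by exact: measurable_int If.
have mI n : measurable (I n) by exact: measurable_itv.
have lim_I : (\int[lebesgue_measure]_(x in I n) f x)%E @[n --> \oo]
    --> (\int[lebesgue_measure]_x f x)%E.
  under eq_fun do rewrite integral_mkcond.
  have [||||//] := @dominated_convergence _ _ R lebesgue_measure setT measurableT
    (fun n => f \_ (I n)) f (abse \o f) _ mf.
  - by move=> n; apply/(measurable_restrictT f (mI n)); exact: measurable_funTS.
  - apply: aeW => x _; apply: cvg_near_cst; near=> n.
    rewrite patchE mem_set// /I/= in_itv/= -ler_norml.
    rewrite (@le_trans _ _ n%:R)// ?ler_nat//; near: n; exact: nbhs_infty_ger.
  - exact: integrable_abse.
  - apply: aeW => x n _; rewrite patchE; case: ifPn => //=.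
    by rewrite normr0 lee_fin.
have IE n : (\int[lebesgue_measure]_(x in I n) f x)%E
    = (poly_gauss R P (a n) - poly_gauss R P (- a n))%:E.
  rewrite /f/= (@continuous_FTC2 _ _ (poly_gauss R P))//.
  - by rewrite gtrN// ltr0n.
  - exact/continuous_subspaceT/continuous_poly_gauss.
  - split.
    + by move=> x _; have [] := is_derive_poly_gauss R P x.
    + exact/cvg_at_right_filter/continuous_poly_gauss.
    + exact/cvg_at_left_filter/continuous_poly_gauss.
  - by move=> x _; rewrite derive1E; have [_ ->] := is_derive_poly_gauss R P x.
have lim0 : (poly_gauss R P (a n) - poly_gauss R P (- a n)) @[n --> \oo] --> (0 : R).
  rewrite -(subr0 (0 : R)); apply: cvgB; apply: poly_gauss_cvg0 => n.
    by rewrite ger0_norm.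
  by rewrite normrN ger0_norm.
rewrite /gauss_int /Rintegral -/f; rewrite (funext IE) in lim_I.
have : (poly_gauss R P (a n) - poly_gauss R P (- a n))%:E @[n --> \oo] --> 0%E.
  by apply/fine_cvgP; split; [exact: nearW|exact: lim0].
by move/(cvg_unique _ lim_I) => ->.
Unshelve. all: end_near. Qed.

(** * Hermite functions and their moments *)

Lemma deriv_hermiteS (R : realType) (n : nat) :
  (hermite R n.+1)^`() = (2 * n.+1%:R) *: hermite R n.
Proof.
elim: n => [|n IH].
  by rewrite /= mulr1 derivB derivZ derivX -polyC1 derivC deriv0 subr0 mulr1.
rewrite -[hermite R n.+2]/(2%:R *: ('X * hermite R n.+1) - (hermite R n.+1)^`()).
rewrite derivB derivZ derivM derivX mul1r IH.
rewrite [(_ *: hermite R n)^`()]derivZ scalerDr -scalerAr scalerA [2 * (2 * _)]mulrC.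
rewrite -[(_ * 2) *: _]scalerA -addrA -scalerBr.
rewrite -[2 *: _ - _]/(hermite R n.+1) -scalerDl.
by rewrite -[n.+2%:R]natr1; congr (_ *: _); ring.
Qed.

Definition psi_norm (R : realType) (n : nat) : R :=
  (Num.sqrt (Num.sqrt pi * 2 ^+ n * n`!%:R))^-1.

Definition psi_poly (R : realType) (n : nat) : {poly R} :=
  psi_norm R n *: hermite R n.

Lemma psiE (R : realType) (n : nat) (x : R) :
  psi n x = poly_gauss R (psi_poly R n) x.
Proof. by rewrite /poly_gauss hornerZ. Qed.

(** The matrix element sqrt (n / 2) of multiplication by xi, and up to sign of
    differentiation, between the Hermite functions n - 1 and n. *)
Definition ladder (R : realType) (n : nat) : R := Num.sqrt (n%:R / 2).

Lemma ladder0 (R : realType) : ladder R 0 = 0.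
Proof. by rewrite /ladder mul0r sqrtr0. Qed.

Lemma ladder_sqr (R : realType) n : ladder R n ^+ 2 = n%:R / 2.
Proof. by rewrite sqr_sqrtr// divr_ge0. Qed.

Lemma psi_normS (R : realType) n :
  ladder R n.+1 * psi_norm R n.+1 = psi_norm R n / 2.
Proof.
rewrite /psi_norm /ladder.
have a0 : 0 < Num.sqrt pi * 2 ^+ n * n`!%:R :> R.
  by rewrite !mulr_gt0// ?sqrtr_gt0 ?pi_gt0 ?exprn_gt0// ltr0n fact_gt0.
have l0 : 0 < n.+1%:R / 2 :> R by rewrite divr_gt0.
have -> : Num.sqrt pi * 2 ^+ n.+1 * (n.+1)`!%:R
    = n.+1%:R / 2 * (2 ^+ 2 * (Num.sqrt pi * 2 ^+ n * n`!%:R)) :> R.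
  by rewrite factS natrM exprS; field.
rewrite (sqrtrM _ (ltW l0)).
rewrite [Num.sqrt (2 ^+ 2 * _)]sqrtrM ?exprn_ge0// sqrtr_sqr ger0_norm//.
have {}l0 : Num.sqrt (n.+1%:R / 2) != 0 :> R by rewrite gt_eqF// sqrtr_gt0.
by rewrite !invfM mulVKf// mulrC.
Qed.

(** At n = 0 the predecessor n.-1 is 0 instead of -1, which is harmless because
    the coefficient [ladder R 0] vanishes; the same convention is used in every
    ladder relation below. *)
Lemma deriv_psi_poly_half (R : realType) n :
  2^-1 *: (psi_poly R n)^`() = ladder R n *: psi_poly R n.-1.
Proof.
rewrite /psi_poly derivZ; case: n => [|n].
  by rewrite /= -polyC1 derivC !scaler0 ladder0 scale0r.
rewrite deriv_hermiteS !scalerA /=; congr (_ *: _).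
have := psi_normS R n; have := ladder_sqr R n.+1; move: (ladder _ _) => l l2.
move=> /(congr1 ( *%R (2 * l))); rewrite !mulrA -[2 * l * l]mulrA -expr2 l2 => E.
have -> : l * psi_norm R n = 2 * l * psi_norm R n / 2 by field.
by rewrite -E; field.
Qed.

Lemma ladder_psi_poly (R : realType) n :
  ladder R n.+1 *: psi_poly R n.+1
  = 'X * psi_poly R n - 2^-1 *: (psi_poly R n)^`().
Proof.
rewrite /psi_poly scalerA psi_normS /= scalerBr scalerA divfK ?pnatr_eq0//.
by rewrite -scalerAr derivZ scalerA [2^-1 * _]mulrC.
Qed.

Lemma mulX_psi_poly (R : realType) n :
  'X * psi_poly R n
  = ladder R n *: psi_poly R n.-1 + ladder R n.+1 *: psi_poly R n.+1.
Proof. by rewrite ladder_psi_poly -deriv_psi_poly_half addrC subrK. Qed.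

(** P' - X P is the polynomial factor of (P w)', so this is the ladder relation
    for psi_n'. *)
Lemma deriv_psi_poly (R : realType) n :
  (psi_poly R n)^`() - 'X * psi_poly R n
  = ladder R n *: psi_poly R n.-1 - ladder R n.+1 *: psi_poly R n.+1.
Proof.
rewrite ladder_psi_poly -deriv_psi_poly_half opprB addrA -scalerDl.
by rewrite -[X in X *: _](_ : 1 = _) ?scale1r//; field.
Qed.

(** Substitution for functions of either sign, by reduction to their positive
    and negative parts. *)
Lemma integral_affine (R : realType) (a b : R) (g : R -> R) :
  0 < a -> continuous g ->
  \int[lebesgue_measure]_v g v = \int[lebesgue_measure]_x (g (a * x + b) * a).
Proof.
move=> a0 cg.
have dF (x : R) : is_derive x (1 : R) (fun x => a * x + b) a.
  have -> : (fun x => a * x + b) = horner (a *: 'X + b%:P).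
    by apply/funext => y; rewrite hornerD hornerZ hornerX hornerC.
  apply: (is_derive_eq (is_derive_poly _ _)).
  by rewrite derivD derivZ derivX derivC addr0 hornerZ hornerC mulr1.
have F' : (fun x => a * x + b)^`()%classic = cst a.
  by apply/funext => x; rewrite derive1E; have [_ ->] := dF x.
have subst (h : R -> R) : continuous h -> (forall x, 0 <= h x) ->
    (\int[lebesgue_measure]_v (h v)%:E
     = \int[lebesgue_measure]_x (h (a * x + b) * a)%:E)%E.
  move=> ch h0.
  rewrite (@increasing_ge0_integration_by_substitutionT _ (fun x => a * x + b))//.
  - by rewrite F'.
  - by move=> x y xy; rewrite ltrD2r ltr_pM2l.
  - by rewrite F' => x; exact: cvg_cst.
  - by rewrite F'; exact: is_cvg_cst.
  - by rewrite F'; exact: is_cvg_cst.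
  - apply/cvgrNyPle => M; near=> x.
    by rewrite -lerBrDr mulrC -ler_pdivlMr//; near: x; exact: nbhs_ninfty_le.
  - apply/cvgryPge => M; near=> x.
    by rewrite -lerBlDr mulrC -ler_pdivrMr//; near: x; exact: nbhs_pinfty_ge.
have maxM (x : R) : Num.max (g (a * x + b) * a) 0 = Num.max (g (a * x + b)) 0 * a.
  by rewrite -[0 in LHS](mul0r a) maxr_pMl// ltW.
have maxNM (x : R) :
    Num.max (- (g (a * x + b) * a)) 0 = Num.max (- g (a * x + b)) 0 * a.
  by rewrite -mulNr -[0 in LHS](mul0r a) maxr_pMl// ltW.
congr fine; rewrite integralE [RHS]integralE.
rewrite ![((fun x => (_ x)%:E)^\+)%E]funerpos ![((fun x => (_ x)%:E)^\-)%E]funerneg.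
congr (_ - _)%E.
  rewrite subst => [|x|x]; last 2 first.
  - by apply: max_fun_continuous => // y; exact: cvg_cst.
  - by rewrite le_max lexx orbT.
  by apply: eq_integral => x _; rewrite funeposE -EFin_max maxM.
rewrite subst => [|x|x]; last 2 first.
- apply: max_fun_continuous => y; last exact: cvg_cst.
  by apply: cvgN; exact: cg.
- by rewrite le_max lexx orbT.
by apply: eq_integral => x _; rewrite funenegE -EFinN -EFin_max maxNM.
Unshelve. all: end_near. Qed.

Definition psi_moment (R : realType) (P : {poly R}) (n : nat) : R :=
  gauss_int R (P * psi_poly R n).

Lemma psi_momentD (R : realType) (P Q : {poly R}) n :
  psi_moment R (P + Q) n = psi_moment R P n + psi_moment R Q n.
Proof. by rewrite /psi_moment mulrDl gauss_intD. Qed.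

Lemma psi_momentZ (R : realType) (c : R) (P : {poly R}) n :
  psi_moment R (c *: P) n = c * psi_moment R P n.
Proof. by rewrite /psi_moment -scalerAl gauss_intZ. Qed.

Lemma psi_intE (R : realType) n : psi_int R n = psi_moment R 1 n.
Proof.
rewrite /psi_moment mul1r; apply: eq_Rintegral => x _; exact: psiE.
Qed.

(** Integration by parts moves the derivative from P to psi_n, where the ladder
    relation evaluates it. *)
Lemma psi_moment_deriv (R : realType) (P : {poly R}) n :
  psi_moment R P^`() n
  = ladder R n.+1 * psi_moment R P n.+1 - ladder R n * psi_moment R P n.-1.
Proof.
have := gauss_int_by_parts R (P * psi_poly R n).
rewrite derivM gauss_intD mulrCA => /(canRL (addrK _)); rewrite {1}/psi_moment => ->.
rewrite /psi_moment -!gauss_intZ -mulN1r -gauss_intZ -gauss_intD.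
rewrite -[X in _ = _ + X]mulN1r -gauss_intZ -gauss_intD; congr gauss_int.
rewrite !scaleN1r -mulrBr -[_ - (psi_poly R n)^`()]opprB deriv_psi_poly.
by rewrite opprB mulrBr -!scalerAr.
Qed.

Lemma psi_moment_mulX (R : realType) (P : {poly R}) n :
  psi_moment R ('X * P) n
  = ladder R n * psi_moment R P n.-1 + ladder R n.+1 * psi_moment R P n.+1.
Proof.
rewrite /psi_moment -!gauss_intZ -gauss_intD; congr gauss_int.
by rewrite [_ * P]mulrC -mulrA mulX_psi_poly mulrDr -!scalerAr.
Qed.

Lemma psi_int_ladder (R : realType) n :
  ladder R n.+1 * psi_int R n.+1 = ladder R n * psi_int R n.-1.
Proof.
apply/eqP; rewrite -subr_eq0 !psi_intE -psi_moment_deriv -polyC1 derivC.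
by rewrite -(scale0r (0 : {poly R})) psi_momentZ mul0r.
Qed.

Lemma psi_int_odd (R : realType) n : odd n -> psi_int R n = 0.
Proof.
have l0 k : ladder R k.+1 != 0 by rewrite gt_eqF// sqrtr_gt0 divr_gt0.
elim/ltn_ind: n => -[//|[_ _|n IH /= on]].
  by apply: (mulfI (l0 0%N)); rewrite psi_int_ladder ladder0 mul0r mulr0.
apply: (mulfI (l0 n.+1)); rewrite psi_int_ladder /= IH ?mulr0//.
by rewrite -[odd n]negbK.
Qed.

(** The velocity v as a function of the rescaled variable xi. *)
Definition speed_poly (R : realType) (alpha u : R) : {poly R} :=
  alpha *: 'X + u%:P.

Definition energy_weight (R : realType) (alpha u : R) (n : nat) : R :=
  psi_moment R (speed_poly R alpha u ^+ 2) n.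

Lemma psi_momentX (R : realType) n :
  psi_moment R 'X n = 2 * ladder R n * psi_int R n.-1.
Proof.
by rewrite -[X in psi_moment _ X]mulr1 psi_moment_mulX -!psi_intE psi_int_ladder; ring.
Qed.

Lemma psi_moment_speed (R : realType) (alpha u : R) n :
  psi_moment R (speed_poly R alpha u) n
  = 2 * alpha * ladder R n * psi_int R n.-1 + u * psi_int R n.
Proof.
rewrite psi_momentD psi_momentZ psi_momentX -alg_polyC psi_momentZ -psi_intE; ring.
Qed.

(** [psi_moment_deriv] for the square of the speed: the force does work at the
    rate given by the first velocity moment. *)
Lemma energy_weight_ladder (R : realType) (alpha u : R) n :
  ladder R n.+1 * energy_weight R alpha u n.+1
  - ladder R n * energy_weight R alpha u n.-1
  = 2 * alpha * psi_moment R (speed_poly R alpha u) n.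
Proof.
rewrite -psi_moment_deriv -psi_momentZ; congr psi_moment.
have -> : (speed_poly R alpha u ^+ 2)^`()
    = (speed_poly R alpha u)^`() * speed_poly R alpha u *+ 2.
  by rewrite expr2 derivM [X in _ + X]mulrC mulr2n.
rewrite derivD derivZ derivX derivC addr0 -scalerAl mul1r.
by rewrite -scaler_nat scalerA.
Qed.

Lemma energy_weightE (R : realType) (alpha u : R) n :
  energy_weight R alpha u n
  = ((2 * n)%:R + 1) * alpha ^+ 2 * psi_int R n
    + 4 * alpha * u * ladder R n * psi_int R n.-1 + u ^+ 2 * psi_int R n.
Proof.
rewrite /energy_weight; have -> : speed_poly R alpha u ^+ 2
    = alpha ^+ 2 *: ('X * 'X) + ((2 * alpha * u) *: 'X + (u ^+ 2) *: 1).
  by rewrite /speed_poly -!mul_polyC !polyC_exp !polyCM polyC_natr; ring.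
rewrite !psi_momentD !psi_momentZ psi_moment_mulX -psi_intE.
rewrite !psi_momentX /= natrM.
have lK : ladder R n * (2 * ladder R n.-1 * psi_int R n.-1.-1)
    = n%:R * psi_int R n.
  case: n => [|n]; first by rewrite ladder0 !mul0r.
  rewrite -[_ * psi_int R _.-1.-1]mulrA -psi_int_ladder/=.
  rewrite (_ : _ * _ = 2 * ladder R n.+1 ^+ 2 * psi_int R n.+1); last by ring.
  by rewrite ladder_sqr; field.
have lS : ladder R n.+1 * (2 * ladder R n.+1 * psi_int R n)
    = (n%:R + 1) * psi_int R n.
  rewrite (_ : _ * _ = 2 * ladder R n.+1 ^+ 2 * psi_int R n); last by ring.
  by rewrite ladder_sqr natr1; field.
rewrite lK lS; ring.
Qed.

(** For odd n only the cross term 2 alpha u of the squared speed survives, as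
    psi_n is odd. *)
Lemma ladder_energy_weight_odd (R : realType) (alpha u : R) n : odd n ->
  ladder R n * energy_weight R alpha u n = 2 * alpha * u * n%:R * psi_int R n.-1.
Proof.
move=> on; rewrite energy_weightE (psi_int_odd R n on).
rewrite (_ : n%:R = 2 * ladder R n ^+ 2); first by ring.
by rewrite ladder_sqr; field.
Qed.

Lemma ladder_energy_weight_even (R : realType) (alpha u : R) n :
  ~~ odd n -> (0 < n)%N ->
  ladder R n * energy_weight R alpha u n
  = ladder R n.-1 * psi_int R n.-2
    * (((2 * n)%:R + 1) * alpha ^+ 2 + u ^+ 2).
Proof.
case: n => // n on _; rewrite energy_weightE/= -psi_int_ladder.
by rewrite (psi_int_odd R n); [ring|move: on; rewrite negbK].
Qed.

(** The substitution v = alpha x + u turns the kinetic energy density of one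
    species into moments of the Hermite functions. *)
Lemma integral_energy_density (R : realType) (alpha u : R) (N : nat) (c : nat -> R) :
  0 < alpha ->
  \int[lebesgue_measure]_v (v ^+ 2 * \sum_(n < N) c n * psi n ((v - u) / alpha))
  = alpha * \sum_(n < N) c n * energy_weight R alpha u n.
Proof.
move=> a0; pose F := \sum_(n < N) c n *: psi_poly R n.
pose V (v : R) : R := v ^+ 2 * poly_gauss R F ((v - u) / alpha).
have FE x : \sum_(n < N) c n * psi n x = poly_gauss R F x.
  rewrite /poly_gauss /F horner_sum mulr_suml; apply: eq_bigr => n _.
  by rewrite psiE hornerZ mulrA.
rewrite (_ : \int[_]_v _ = \int[lebesgue_measure]_v V v); last first.
  by apply: eq_Rintegral => v _; rewrite FE.
rewrite (integral_affine R alpha u)//; last first.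
  have aff (x : R) : ((fun v => (v - u) / alpha) y @[y --> x] --> (x - u) / alpha).
    by apply: cvgMl; apply: cvgB => //; exact: cvg_cst.
  move=> x; apply: cvgM; first exact: exprn_continuous.
  by apply: continuous_cvg; [exact: continuous_poly_gauss|exact: aff].
transitivity (\int[lebesgue_measure]_x
  (alpha * poly_gauss R (speed_poly R alpha u ^+ 2 * F) x)).
  apply: eq_Rintegral => x _; rewrite /V addrK [alpha * x]mulrC mulfK ?gt_eqF//.
  rewrite /poly_gauss /speed_poly expr2 !hornerM hornerD hornerZ hornerX hornerC.
  by ring.
rewrite RintegralZl//; last exact: integrable_poly_gauss.
congr (_ * _); rewrite -/(gauss_int R _) mulr_sumr.
rewrite (big_morph (gauss_int R) (gauss_intD R) (_ : _ = 0)); last first.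
  by rewrite -(scale0r (0 : {poly R})) gauss_intZ mul0r.
by apply: eq_bigr => n _; rewrite -scalerAr gauss_intZ.
Qed.

(** * Summation by parts over the modes *)

(** Shifting the index leaves the term of index N, which has no counterpart in
    the truncated sum. *)
Lemma sum_prev_mode (R : realType) (Nx N : nat) (w : nat -> R)
    (c : nat -> 'cV[R]_Nx) : (0 < N)%N ->
  \sum_(n < N) w n *: (ladder R n *: prev_mode c n)
  = \sum_(n < N) (ladder R n.+1 * w n.+1) *: c n
    - (ladder R N * w N) *: c N.-1.
Proof.
case: N => // N _; rewrite big_ord_recl/= !scaler0 add0r big_ord_recr/= addrK.
by apply: eq_bigr => n _; rewrite scalerA mulrC.
Qed.

Lemma sum_next_mode (R : realType) (Nx N : nat) (w : nat -> R)
    (c : nat -> 'cV[R]_Nx) :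
  \sum_(n < N) w n *: (ladder R n.+1 *: next_mode N c n)
  = \sum_(n < N) (ladder R n * w n.-1) *: c n.
Proof.
case: N => [|N]; first by rewrite !big_ord0.
rewrite big_ord_recr/= /next_mode ltnn !scaler0 addr0.
rewrite big_ord_recl/= ladder0 mul0r scale0r add0r.
by apply: eq_bigr => n _; rewrite /= !ltnS ltn_ord scalerA mulrC.
Qed.

(** * Time derivatives of matrix-valued functions *)

Lemma is_derive_bigsum (R : realType) (V : normedModType R) (I : Type)
    (r : seq I) (f : I -> R -> V) (df : I -> V) (t : R) :
  (forall i, is_derive t (1 : R) (f i) (df i)) ->
  is_derive t (1 : R) (fun x => \sum_(i <- r) f i x) (\sum_(i <- r) df i).
Proof.
move=> h; elim: r => [|i r IH].
  rewrite big_nil (_ : (fun _ => _) = cst 0); first exact: is_derive_cst.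
  by apply/funext => x; rewrite big_nil.
rewrite big_cons (_ : (fun x => _) = f i + (fun x => \sum_(j <- r) f j x)).
  exact: is_deriveD.
by apply/funext => x; rewrite big_cons.
Qed.

Lemma is_derive_mx_entry (R : realType) (k l : nat) (M : R -> 'M[R]_(k, l))
    (dM : 'M[R]_(k, l)) (t : R) (i : 'I_k) (j : 'I_l) :
  is_derive t (1 : R) M dM ->
  is_derive t (1 : R) (fun x => M x i j) (dM i j).
Proof.
move=> [Mt <-]; apply: DeriveDef; first by move/derivable_mxP : Mt.
by rewrite derive_mx// mxE.
Qed.

Lemma is_derive_mx (R : realType) (k l : nat) (M : R -> 'M[R]_(k, l))
    (dM : 'M[R]_(k, l)) (t : R) :
  (forall i j, is_derive t (1 : R) (fun x => M x i j) (dM i j)) ->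
  is_derive t (1 : R) M dM.
Proof.
move=> h; have Mt : derivable M t (1 : R).
  by apply/derivable_mxP => i j; have [] := h i j.
apply: DeriveDef => //; rewrite derive_mx//; apply/matrixP => i j.
by rewrite mxE; have [_ ->] := h i j.
Qed.

Lemma is_derive_mulmx (R : realType) (k l m : nat) (A : 'M[R]_(k, l))
    (M : R -> 'M[R]_(l, m)) (dM : 'M[R]_(l, m)) (t : R) :
  is_derive t (1 : R) M dM ->
  is_derive t (1 : R) (fun x => A *m M x) (A *m dM).
Proof.
move=> h; apply: is_derive_mx => i j.
rewrite mxE (_ : (fun x => _) = fun x => \sum_l0 A i l0 * M x l0 j); last first.
  by apply/funext => x; rewrite mxE.
apply: is_derive_bigsum => l0.
exact: is_deriveZ (is_derive_mx_entry _ _ _ _ _ _ _ _ h).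
Qed.

Lemma is_derive_cst_interval (R : realType) (J : set R) (f : R -> R) (a b : R) :
  open J -> is_interval J -> (forall t, J t -> is_derive t (1 : R) f 0) ->
  J a -> J b -> f a = f b.
Proof.
move=> oJ iJ f0; wlog ab : a b / a <= b.
  by move=> wl Ja Jb; have [ab|/ltW ba] := leP a b; [|apply/esym]; exact: wl.
move=> Ja Jb.
have abJ x : x \in `[a, b] -> J x.
  by rewrite in_itv/= => xab; apply: (iJ a b).
have [||x _] := @MVT_segment R f (cst 0) a b ab.
- by move=> x xab; apply: f0; apply: abJ; exact: subset_itv_oo_cc xab.
- apply: derivable_within_continuous => x xab.
  by have [] := f0 x (abJ x xab).
by rewrite mul0r => /eqP; rewrite subr_eq0 => /eqP.
Qed.

(** * Rates of the kinetic energy and of the charge *)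

Definition dotc (R : realType) (n : nat) (x y : 'cV[R]_n) : R := (x^T *m y) 0 0.

Lemma dotcD (R : realType) (n : nat) (x y z : 'cV[R]_n) :
  dotc R n x (y + z) = dotc R n x y + dotc R n x z.
Proof. by rewrite /dotc mulmxDr mxE. Qed.

Lemma dotcZ (R : realType) (n : nat) a (x y : 'cV[R]_n) :
  dotc R n x (a *: y) = a * dotc R n x y.
Proof. by rewrite /dotc -scalemxAr mxE. Qed.

Lemma dotcN (R : realType) (n : nat) (x y : 'cV[R]_n) :
  dotc R n x (- y) = - dotc R n x y.
Proof. by rewrite -scaleN1r dotcZ mulN1r. Qed.

Lemma dotc_sum (R : realType) (n : nat) (I : Type) (r : seq I)
    (x : 'cV[R]_n) (y : I -> 'cV[R]_n) :
  dotc R n x (\sum_(i <- r) y i) = \sum_(i <- r) dotc R n x (y i).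
Proof. by rewrite /dotc mulmx_sumr summxE. Qed.

Lemma dotcE (R : realType) (n : nat) (x y : 'cV[R]_n) :
  dotc R n x y = \sum_j x j 0 * y j 0.
Proof. by rewrite /dotc mxE; apply: eq_bigr => j _; rewrite mxE. Qed.

Lemma hadamardZ (R : realType) (n : nat) a (x y : 'cV[R]_n) :
  hadamard x (a *: y) = a *: hadamard x y.
Proof. by apply/colP => j; rewrite !mxE mulrCA. Qed.

Lemma hadamardD (R : realType) (n : nat) (x y z : 'cV[R]_n) :
  hadamard x (y + z) = hadamard x y + hadamard x z.
Proof. by apply/colP => j; rewrite !mxE mulrDr. Qed.

Lemma hadamard_sum (R : realType) (n : nat) (I : Type) (r : seq I)
    (x : 'cV[R]_n) (y : I -> 'cV[R]_n) :
  hadamard x (\sum_(i <- r) y i) = \sum_(i <- r) hadamard x (y i).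
Proof.
apply: (big_morph (hadamard x) (hadamardD _ _ x)).
by apply/colP => j; rewrite !mxE mulr0.
Qed.

(** Summing over the grid removes the transport term, so only the acceleration
    by the field changes the mass of a mode. *)
Lemma sum_sw_rhs (R : realType) (q u m alpha ell : R) (Nx Nv p : nat)
    (c : nat -> 'cV[R]_Nx) (e : 'cV[R]_Nx) (n : nat) :
  ~~ odd p -> (p < Nx)%N ->
  \sum_j sw_rhs q u m alpha ell Nv p c e n j 0
  = q / (m * alpha)
    * dotc R Nx e (ladder R n *: prev_mode c n
                   - ladder R n.+1 *: next_mode Nv c n).
Proof.
move=> p_even pNx; rewrite /sw_rhs -mulmxN.
under eq_bigr do rewrite mxE.
rewrite big_split/= sum_fd_mx_mul// add0r dotcE mulr_sumr.
by apply: eq_bigr => j _; rewrite !mxE.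
Qed.

Lemma sum_weighted_coupling (R : realType) (Nx N : nat) (w : nat -> R)
    (c : nat -> 'cV[R]_Nx) : (0 < N)%N ->
  \sum_(n < N) w n *: (ladder R n *: prev_mode c n
                       - ladder R n.+1 *: next_mode N c n)
  = \sum_(n < N) (ladder R n.+1 * w n.+1 - ladder R n * w n.-1) *: c n
    - (ladder R N * w N) *: c N.-1.
Proof.
move=> N0; under eq_bigr do rewrite scalerBr.
rewrite sumrB sum_prev_mode// sum_next_mode addrAC -sumrB.
by congr (_ - _); apply: eq_bigr => n _; rewrite -scalerBl.
Qed.

(** The work of the field on the current of one species, corrected by the
    boundary term of the truncation. *)
Definition kinetic_rate (R : realType) (q alpha u : R) (Nx N : nat)
    (c : nat -> 'cV[R]_Nx) (e : 'cV[R]_Nx) : R :=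
  q * (alpha * \sum_(n < N)
          psi_moment R (speed_poly R alpha u) n * dotc R Nx e (c n)
       - ladder R N * energy_weight R alpha u N / 2 * dotc R Nx e (c N.-1)).

Lemma sum_energy_weight_rhs (R : realType) (q u m alpha ell : R) (Nx Nv p : nat)
    (c : nat -> 'cV[R]_Nx) (e : 'cV[R]_Nx) :
  0 < m -> 0 < alpha -> (0 < Nv)%N -> ~~ odd p -> (p < Nx)%N ->
  m * \sum_(j < Nx) (alpha * \sum_(n < Nv)
       sw_rhs q u m alpha ell Nv p c e n j 0 * energy_weight R alpha u n)
  = 2 * kinetic_rate R q alpha u Nx Nv c e.
Proof.
move=> m0 a0 N0 p_even pNx; rewrite -mulr_sumr exchange_big/=.
under eq_bigr do
  rewrite -mulr_suml sum_sw_rhs// -mulrA [dotc _ _ _ _ * _]mulrC -dotcZ.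
rewrite -mulr_sumr -dotc_sum sum_weighted_coupling// dotcD dotcN dotcZ dotc_sum.
under eq_bigr do rewrite dotcZ energy_weight_ladder -!mulrA.
rewrite -!mulr_sumr /kinetic_rate; field; lra.
Qed.

(** The source in the continuity equation caused by the truncation: without it
    the charge would only be transported. *)
Definition truncation_charge (R : realType) (q m alpha : R) (Nx N : nat)
    (c : nat -> 'cV[R]_Nx) (e : 'cV[R]_Nx) : 'cV[R]_Nx :=
  (q ^+ 2 / m * (ladder R N * psi_int R N)) *: hadamard e (c N.-1).

(** The electric current carried by the modes, including the boundary term of
    the truncated transport. *)
Definition current (R : realType) (q alpha u : R) (Nx N : nat)
    (c : nat -> 'cV[R]_Nx) : 'cV[R]_Nx :=
  (q * alpha) *: (\sum_(n < N) psi_moment R (speed_poly R alpha u) n *: c n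
                  - (alpha * (ladder R N * psi_int R N)) *: c N.-1).

Lemma sum_weighted_transport (R : realType) (alpha u : R) (Nx N : nat)
    (c : nat -> 'cV[R]_Nx) : (0 < N)%N ->
  \sum_(n < N) psi_int R n *:
     ((alpha * ladder R n) *: prev_mode c n
      + (alpha * ladder R n.+1) *: next_mode N c n + u *: c n)
  = \sum_(n < N) psi_moment R (speed_poly R alpha u) n *: c n
    - (alpha * (ladder R N * psi_int R N)) *: c N.-1.
Proof.
move=> N0.
under eq_bigr do rewrite -!scalerA 2!scalerDr ![_ *: (alpha *: _)]scalerA
  ![_ * alpha]mulrC -!scalerA.
rewrite 2!big_split/= -!scaler_sumr sum_prev_mode// sum_next_mode.
rewrite scalerBr [alpha *: (_ *: c _)]scalerA -addrA addrAC; congr (_ - _).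
rewrite !scaler_sumr -!big_split/=; apply: eq_bigr => n _.
rewrite !scalerA -!scalerDl; congr (_ *: _).
by rewrite psi_moment_speed psi_int_ladder; ring.
Qed.

(** The discrete continuity equation.  The acceleration by the field conserves
    the charge up to the boundary term, because [psi_int_ladder] makes its
    interior coefficients vanish. *)
Lemma charge_rate (R : realType) (q u m alpha ell : R) (Nx Nv p : nat)
    (c : nat -> 'cV[R]_Nx) (e : 'cV[R]_Nx) :
  0 < m -> 0 < alpha -> (0 < Nv)%N ->
  (q * alpha) *: (\sum_(n < Nv)
       psi_int R n *: sw_rhs q u m alpha ell Nv p c e n)
  = - (fd_mx ell Nx p *m current R q alpha u Nx Nv c)
    - truncation_charge R q m alpha Nx Nv c e.
Proof.
move=> m0 a0 N0.
have rhsE n : psi_int R n *: sw_rhs q u m alpha ell Nv p c e n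
    = - (fd_mx ell Nx p *m (psi_int R n *:
          ((alpha * ladder R n) *: prev_mode c n
           + (alpha * ladder R n.+1) *: next_mode Nv c n + u *: c n)))
      + (q / (m * alpha)) *: hadamard e (psi_int R n *:
          (ladder R n *: prev_mode c n - ladder R n.+1 *: next_mode Nv c n)).
  rewrite /sw_rhs scalerDr scalerN scalemxAr hadamardZ; congr (_ + _).
  by rewrite !scalerA mulrC.
under eq_bigr do rewrite rhsE.
rewrite big_split/= sumrN -mulmx_sumr -scaler_sumr -hadamard_sum.
rewrite sum_weighted_transport// sum_weighted_coupling//.
have -> : \sum_(n < Nv) (ladder R n.+1 * psi_int R n.+1
    - ladder R n * psi_int R n.-1) *: c n = 0.
  by rewrite big1// => n _; rewrite psi_int_ladder subrr scale0r.
rewrite sub0r.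
rewrite scalerDr scalerN -scalemxAr; congr (_ + _).
rewrite -[- (_ *: c _)]scaleNr hadamardZ !scalerA /truncation_charge.
rewrite -[- (_ *: hadamard _ _)]scaleNr; congr (_ *: _).
field; lra.
Qed.

(** * Energy balance *)

Lemma kinetic_energyE (R : realType) (S : finType) (u m alpha : S -> R)
    (ell : R) (Nx Nv : nat) (C : S -> nat -> R -> 'cV[R]_Nx) (t : R) :
  (forall s, 0 < alpha s) ->
  kinetic_energy u m alpha ell Nv C t
  = grid_step ell Nx / 2 * \sum_s m s * \sum_(j < Nx)
      (alpha s * \sum_(n < Nv) C s n t j 0 * energy_weight R (alpha s) (u s) n).
Proof.
move=> a0; rewrite /kinetic_energy /trapz [LHS]mulr_sumr [RHS]mulr_sumr.
apply: eq_bigr => s _; under eq_bigr => j _ do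
  rewrite (integral_energy_density _ _ _ _ (fun n => C s n t j 0))//.
by ring.
Qed.

(** The work on the current that the kinetic energy gains is what the field
    energy loses, so the moments of all modes cancel and only the boundary terms
    in the last mode remain. *)
Lemma net_rate (R : realType) (q alpha u : R) (Nx N : nat)
    (c : nat -> 'cV[R]_Nx) (e : 'cV[R]_Nx) :
  kinetic_rate R q alpha u Nx N c e
    - dotc R Nx e (current R q alpha u Nx N c)
  = - (q * (ladder R N * energy_weight R alpha u N / 2
            - alpha ^+ 2 * (ladder R N * psi_int R N)) * dotc R Nx e (c N.-1)).
Proof.
rewrite /kinetic_rate /current dotcZ dotcD dotcN dotcZ dotc_sum.
by under [in X in _ - X]eq_bigr do rewrite dotcZ; ring.
Qed.

Section EnergyRate.
Variables (R : realType) (S : finType) (q u m alpha : S -> R).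
Variables (ell : R) (Nx Nv p : nat) (J : set R).
Variables (C : S -> nat -> R -> 'cV[R]_Nx) (E : R -> 'cV[R]_Nx).
Hypotheses (m_gt0 : forall s, 0 < m s) (alpha_gt0 : forall s, 0 < alpha s).
Hypotheses (ell_gt0 : 0 < ell) (Nv_gt0 : (0 < Nv)%N).
Hypotheses (p_even : ~~ odd p) (p_gt0 : (0 < p)%N) (p_lt_Nx : (p < Nx)%N).
Hypotheses (J_open : open J).
Hypothesis sol : sw_solution q u m alpha ell Nv p J C E.

Local Notation D := (fd_mx ell Nx p).
Local Notation rhs t s n :=
  (sw_rhs (q s) (u s) (m s) (alpha s) ell Nv p (fun k => C s k t) (E t) n).

Lemma pinv_fd_mx_field t : J t -> mp_pinv D *m D *m E t = E t.
Proof.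
move=> Jt; have dx0 : grid_step ell Nx != 0.
  by rewrite mulf_neq0 ?gt_eqF// invr_gt0 ltr0n; case: (Nx) p_lt_Nx.
apply: mp_pinv_fd_mxK => //; last by move=> nodd; exact: (sw_sawtooth sol).
have := sw_zero_mean sol Jt; rewrite /trapz => /eqP.
by rewrite mulf_eq0 (negbTE dx0) => /eqP.
Qed.

(** D^+ D is symmetric, so it may be moved onto E, which it fixes. *)
Lemma dotc_pinv_fd_mx t (y : 'cV[R]_Nx) : J t ->
  dotc R Nx (E t) (mp_pinv D *m (D *m y)) = dotc R Nx (E t) y.
Proof.
move=> Jt; have [_ _ _ PDs] := mp_pinvP D.
rewrite /dotc (_ : _ *m _ = (E t)^T *m (mp_pinv D *m D) *m y); last first.
  by rewrite !mulmxA.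
by rewrite -PDs -trmx_mul pinv_fd_mx_field.
Qed.

Lemma is_derive_sw_charge t : J t ->
  is_derive t (1 : R) (fun x => sw_charge q alpha Nv (fun s k => C s k x))
    (\sum_s (- (D *m current R (q s) (alpha s) (u s) Nx Nv (fun k => C s k t))
             - truncation_charge R (q s) (m s) (alpha s) Nx Nv
                 (fun k => C s k t) (E t))).
Proof.
move=> Jt; apply: is_derive_bigsum => s.
rewrite -(charge_rate R (q s) (u s) (m s) (alpha s) ell Nx Nv p)//.
apply: is_deriveZ; apply: is_derive_bigsum => n; apply: is_deriveZ.
exact: (sw_vlasov sol).
Qed.

(** E inherits its regularity from the modes through E = D^+ D E = D^+ rho,
    which holds near t as J is open. *)
Lemma is_derive_field t : J t ->
  is_derive t (1 : R) E
    (mp_pinv D *m \sum_s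
       (- (D *m current R (q s) (alpha s) (u s) Nx Nv (fun k => C s k t))
        - truncation_charge R (q s) (m s) (alpha s) Nx Nv
            (fun k => C s k t) (E t))).
Proof.
move=> Jt; apply: near_eq_is_derive (is_derive_mulmx _ _ _ _ (mp_pinv D) _ _ _
  (is_derive_sw_charge t Jt)).
near=> x; have Jx : J x by near: x; exact: open_nbhs_nbhs.
by rewrite -(sw_poisson sol)// mulmxA pinv_fd_mx_field.
Unshelve. all: end_near. Qed.

Lemma is_derive_kinetic_energy t : J t ->
  is_derive t (1 : R) (kinetic_energy u m alpha ell Nv C)
    (grid_step ell Nx * \sum_s
       kinetic_rate R (q s) (alpha s) (u s) Nx Nv (fun k => C s k t) (E t)).
Proof.
move=> Jt; rewrite (funext (fun x =>
  kinetic_energyE R S u m alpha ell Nx Nv C x alpha_gt0)).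
have -> : grid_step ell Nx * \sum_s
       kinetic_rate R (q s) (alpha s) (u s) Nx Nv (fun k => C s k t) (E t)
    = grid_step ell Nx / 2 * \sum_s m s * \sum_(j < Nx)
      (alpha s * \sum_(n < Nv)
         rhs t s n j 0 * energy_weight R (alpha s) (u s) n).
  under [in RHS]eq_bigr do rewrite sum_energy_weight_rhs//.
  by rewrite -mulr_sumr mulrA divfK.
apply: is_deriveZ; apply: is_derive_bigsum => s; apply: is_deriveZ.
apply: is_derive_bigsum => j; apply: is_deriveZ; apply: is_derive_bigsum => n.
rewrite mulrC; under eq_fun do rewrite mulrC.
apply: is_deriveZ; apply: is_derive_mx_entry; exact: (sw_vlasov sol).
Qed.

Lemma is_derive_potential_energy t (dE : 'cV[R]_Nx) :
  is_derive t (1 : R) E dE ->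
  is_derive t (1 : R) (potential_energy ell E)
    (grid_step ell Nx * dotc R Nx (E t) dE).
Proof.
move=> hE.
have -> : grid_step ell Nx * dotc R Nx (E t) dE
    = 2^-1 * (grid_step ell Nx * \sum_j 2 * (E t j 0 * dE j 0)).
  by rewrite dotcE -mulr_sumr; field.
apply: is_deriveZ; apply: is_deriveZ; apply: is_derive_bigsum => j.
have h := is_derive_mx_entry _ _ _ _ _ _ j 0 hE.
apply: (is_derive_eq (is_deriveM h h)).
by rewrite /GRing.scale/=; ring.
Qed.

Lemma is_derive_total_energy t : J t ->
  is_derive t (1 : R) (total_energy u m alpha ell Nv C E)
    (- (grid_step ell Nx * \sum_s
      (q s * (ladder R Nv * energy_weight R (alpha s) (u s) Nv / 2
              - alpha s ^+ 2 * (ladder R Nv * psi_int R Nv))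
         * dotc R Nx (E t) (C s Nv.-1 t)
       + dotc R Nx (E t) (mp_pinv D *m truncation_charge R (q s) (m s) (alpha s)
           Nx Nv (fun k => C s k t) (E t))))).
Proof.
move=> Jt; apply: (is_derive_eq (is_deriveD (is_derive_kinetic_energy t Jt)
  (is_derive_potential_energy t _ (is_derive_field t Jt)))).
rewrite -mulrDr -mulrN mulmx_sumr dotc_sum -sumrN -big_split/=.
congr (_ * _); apply: eq_bigr => s _.
rewrite mulmxBr mulmxN dotcD dotcN dotc_pinv_fd_mx// addrA net_rate dotcN.
by rewrite opprD.
Qed.
End EnergyRate.

Theorem theorem6 (R : realType) (S : finType) (q u m alpha : S -> R)
    (ell : R) (Nx Nv p : nat) (J : set R)
    (C : S -> nat -> R -> 'cV[R]_Nx) (E : R -> 'cV[R]_Nx)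
    (m_gt0 : forall s, 0 < m s) (alpha_gt0 : forall s, 0 < alpha s)
    (ell_gt0 : 0 < ell) (Nv_gt0 : (0 < Nv)%N)
    (p_even : ~~ odd p) (p_gt0 : (0 < p)%N) (p_lt_Nx : (p < Nx)%N)
    (J_open : open J) (J_itv : is_interval J)
    (sol : sw_solution q u m alpha ell Nv p J C E) :
  [/\ odd Nv -> (forall s, u s = 0) -> forall t1 t2 : R, J t1 -> J t2 ->
        total_energy u m alpha ell Nv C E t1
        = total_energy u m alpha ell Nv C E t2,
      odd Nv -> forall t : R, J t ->
        is_derive t 1 (total_energy u m alpha ell Nv C E)
          (- (grid_step ell Nx * Nv%:R * psi_int R Nv.-1
              * ((E t)^T *m \sum_s (u s * alpha s * q s) *: C s Nv.-1 t) 0 0))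
    & ~~ odd Nv -> forall t : R, J t ->
        is_derive t 1 (total_energy u m alpha ell Nv C E)
          (- (grid_step ell Nx * Num.sqrt (Nv.-1%:R / 2) * psi_int R Nv.-2
              * ((E t)^T *m \sum_s q s *:
                  ((((2 * Nv)%:R - 1) * alpha s ^+ 2 + u s ^+ 2) / 2
                     *: C s Nv.-1 t
                   + (q s / m s) *: (mp_pinv (fd_mx ell Nx p)
                       *m hadamard (E t) (C s Nv.-1 t)))) 0 0))].
Proof.
have rate t (Jt : J t) := is_derive_total_energy R S q u m alpha ell Nx Nv p J
  C E m_gt0 alpha_gt0 ell_gt0 Nv_gt0 p_even p_gt0 p_lt_Nx J_open sol t Jt.
have odd_rate : odd Nv -> forall t : R, J t ->
    is_derive t 1 (total_energy u m alpha ell Nv C E)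
      (- (grid_step ell Nx * Nv%:R * psi_int R Nv.-1
          * ((E t)^T *m \sum_s (u s * alpha s * q s) *: C s Nv.-1 t) 0 0)).
  move=> oN t Jt; apply: (is_derive_eq (rate t Jt)); congr (- _).
  rewrite -/(dotc R Nx _ _) dotc_sum !mulr_sumr.
  apply: eq_bigr => s _; rewrite /truncation_charge (psi_int_odd R Nv oN).
  rewrite !mulr0 scale0r mulmx0 -(scale0r (0 : 'cV[R]_Nx)) !dotcZ mul0r.
  by rewrite ladder_energy_weight_odd//; field.
split=> //.
  move=> oN u0 t1 t2; apply: is_derive_cst_interval => // t Jt.
  apply: (is_derive_eq (odd_rate oN t Jt)).
  rewrite big1 ?mulmx0 ?mxE ?mulr0 ?oppr0// => s _.
  by rewrite u0 !mul0r scale0r.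
move=> eN t Jt; apply: (is_derive_eq (rate t Jt)); congr (- _).
rewrite -/(ladder R _) -/(dotc R Nx _ _) dotc_sum !mulr_sumr.
apply: eq_bigr => s _.
rewrite /truncation_charge ladder_energy_weight_even// -scalemxAr !(dotcD, dotcZ).
have -> : ladder R Nv * psi_int R Nv = ladder R Nv.-1 * psi_int R Nv.-2.
  by case: (Nv) Nv_gt0 => // k _; rewrite psi_int_ladder.
rewrite natrM; field; exact: lt0r_neq0.
Qed.
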